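(* Let $R$ be a noetherian ring, $0\to\mathcal F\xrightarrow{\chi}\mathcal G$ injective with $\mathcal F,\mathcal G$ free of ranks $m,n$, $r=n-m\ge0$, and suppose $\operatorname{grade}I_\chi=r+1$. Let $\mathcal H$ be free of rank $l\le n$, $\rho=r-l$. Then every $\lambda:\mathcal G\to\mathcal H$ with $\lambda\chi=0$ satisfies $I_\lambda\subset I_\chi$, in particular $\operatorname{grade}I_\lambda\le r+1$. Moreover: (a) if some such $\lambda$ has $\operatorname{grade}I_\lambda>|\rho|+1$, then $l=1$ and $r$ is odd; (b) if in addition $\chi$ is minimal, the following are equivalent: (1) there is such a $\lambda$ with $\operatorname{grade}I_\lambda>|\rho|+1$; (2) $l=1$ and either $r=1$, or $m=1$ and $r\ge3$ is odd; (c) for such a $\lambda$: $\operatorname{grade}I_\lambda>|\rho|+1$ if and only if $I_\lambda=I_\chi$.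
   Context: $I_\chi$, $I_\lambda$ are the ideals generated by the maximal minors of matrices representing $\chi$, $\lambda$. A homomorphism of finite free modules is minimal if the entries of a representing matrix generate a proper ideal of $R$.
   Formalization: The module H is assumed to have rank l ≥ 1; for l = 0 the ideal I_λ is all of R, which is never contained in the proper ideal I_χ, so the statement fails there. *)

(* Defs.v *)
From HB Require Import structures.
From mathcomp Require Import all_boot all_order all_algebra.
Set Implicit Arguments. Unset Strict Implicit. Unset Printing Implicit Defensive.
Import Order.TTheory GRing.Theory Num.Theory.
Local Open Scope ring_scope.

Section Defs.
Variable R : comNzRingType.

Definition ideal_of (s : seq R) : R -> Prop :=
  fun x => exists c : 'I_(size s) -> R, x = \sum_(i < size s) c i * s`_i.

Definition is_ideal (I : R -> Prop) : Prop :=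
  [/\ I 0, (forall x y, I x -> I y -> I (x + y)) & (forall a x, I x -> I (a * x))].

Definition noetherian : Prop :=
  forall I : R -> Prop, is_ideal I -> exists s : seq R, forall x, I x <-> ideal_of s x.

Definition regular_seq (s : seq R) : Prop :=
  (forall i : nat, (i < size s)%N -> forall y,
     ideal_of (take i s) (s`_i * y) -> ideal_of (take i s) y)
  /\ ~ ideal_of s 1.

(* grade I >= k, with the convention grade R = infinity. *)
Definition grade_ge (I : R -> Prop) (k : nat) : Prop :=
  I 1 \/ exists s : seq R, [/\ size s = k, (forall x, x \in s -> I x) & regular_seq s].

(* Ideal of maximal minors of an m x n matrix with m <= n (rows = basis of the
   source, homomorphism u |-> u *m A on row vectors): the m x m minors. *)
Definition maxminors_rows (m n : nat) (A : 'M[R]_(m, n)) : seq R :=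
  [seq \det (colsub f A) | f : {ffun 'I_m -> 'I_n}].

Definition maxminors_cols (n l : nat) (A : 'M[R]_(n, l)) : seq R :=
  [seq \det (rowsub g A) | g : {ffun 'I_l -> 'I_n}].

Definition minimal_mx (m n : nat) (A : 'M[R]_(m, n)) : Prop :=
  ~ ideal_of [seq A ij.1 ij.2 | ij : 'I_m * 'I_n] 1.

End Defs.

Definition absdiff (a b : nat) : nat := (a - b) + (b - a).

(* Main.v *)
Require Import Defs.
From HB Require Import structures.
From mathcomp Require Import all_boot all_order all_fingroup all_algebra.
From mathcomp Require Import ring zify.
From Stdlib Require Import Classical.
Import GRing.Theory.
Local Open Scope ring_scope.
Set Implicit Arguments.
Unset Strict Implicit.
Unset Printing Implicit Defensive.

(* The argument takes place in the exterior algebra of [R^n], with wedge operators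
   [x /\ -] and contractions satisfying [c_u w_x + w_x c_u = <x, u>].  Saito's
   division lemma says that if the maximal minors of [x_1, ..., x_k] contain a
   regular sequence of length [g], then [x_1 /\ ... /\ x_k /\ y = 0] with
   [deg y < g] forces [y] into the left ideal [(x)] generated by the [x_i].
   Consequently an element annihilated by all [x_i] is of the form
   [x_1 /\ ... /\ x_k /\ t] when its degree is less than [g + k - 1].  With the rows
   of [X], applied to the Hodge dual of a column [v] of [L], this puts [v] in
   [I_chi]; with the columns of [L], applied to the Hodge dual of the wedge of the
   rows of [X], it gives [I_chi] inside [I_lam] as soon as
   [grade I_lam > |rho| + 1].  Then [I_chi = I_lam], contained in [I_chi ^ l], so
   [l = 1] by the determinant trick.
   For [l = 1] one obtains [t] of degree [r - 1] such that [c |-> c /\ t] is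
   surjective from [C] to the [r]-th exterior power of [C], where [C = coker X].
   If [X] vanishes modulo a proper ideal, counting ranks gives [binom(n, r) <= n],
   i.e. [m = 1] or [r = 1].  In general, modulo the radical of [I_chi], the form
   [(c, d) |-> c /\ d /\ t] induces a nondegenerate alternating form on a free
   quotient of [C] of rank [r + 1], which must be even. *)

(** * Products of operators with scalar anticommutators *)

Section Words.
Variables (R : comNzRingType) (V : lmodType R).

Fixpoint word m : ('I_m -> {linear V -> V}) -> V -> V :=
  match m with
  | 0 => fun _ y => y
  | m'.+1 => fun F y => F ord0 (word (fun i => F (lift ord0 i)) y)
  end.

(** The order is reversed so that [A ord0] and [B ord0] are adjacent in [rword A (word B y)]; the
    recursion then expands a determinant along its first row. *)
Fixpoint rword m : ('I_m -> {linear V -> V}) -> V -> V :=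
  match m with
  | 0 => fun _ y => y
  | m'.+1 => fun F y => rword (fun i => F (lift ord0 i)) (F ord0 y)
  end.

Lemma wordS m (F : 'I_m.+1 -> {linear V -> V}) y :
  word F y = F ord0 (word (fun i => F (lift ord0 i)) y).
Proof. by []. Qed.

Lemma rwordS m (F : 'I_m.+1 -> {linear V -> V}) y :
  rword F y = rword (fun i => F (lift ord0 i)) (F ord0 y).
Proof. by []. Qed.

Lemma eq_word m (F G : 'I_m -> {linear V -> V}) :
  (forall i y, F i y = G i y) -> word F =1 word G.
Proof.
elim: m F G => [|m IH] F G eFG y //=.
by rewrite eFG (IH _ (fun i => G (lift ord0 i))).
Qed.

Lemma word_is_linear m (F : 'I_m -> {linear V -> V}) : linear (word F).
Proof. by elim: m F => [|m IH] F a u v //=; rewrite IH linearP. Qed.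
HB.instance Definition _ m (F : 'I_m -> {linear V -> V}) :=
  GRing.isLinear.Build R V V _ (word F) (word_is_linear F).

Lemma rword_is_linear m (F : 'I_m -> {linear V -> V}) : linear (rword F).
Proof. by elim: m F => [|m IH] F a u v //=; rewrite linearP IH. Qed.
HB.instance Definition _ m (F : 'I_m -> {linear V -> V}) :=
  GRing.isLinear.Build R V V _ (rword F) (rword_is_linear F).

(** [A] moves right past one factor at a time: after [j] sign changes the scalar [g j] replaces
    [B j]; in the last term [A] has passed every factor. *)
Lemma word_skip m (A : {linear V -> V}) (B : 'I_m.+1 -> {linear V -> V})
    (g : 'I_m.+1 -> R) y :
  (forall j z, A (B j z) = g j *: z - B j (A z)) ->
  A (word B y) =
  \sum_(j < m.+1) ((-1) ^+ j * g j) *: word (fun i => B (lift j i)) y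
  + (-1) ^+ m.+1 *: word B (A y).
Proof.
elim: m B g => [|m IH] B g AB.
  by rewrite /= AB big_ord_recl big_ord0 /= expr0 expr1 mul1r addr0 scaleN1r.
rewrite [in LHS]wordS AB (IH _ (fun j => g (lift ord0 j))) //.
rewrite linearD linear_sum opprD addrA [in RHS]big_ord_recl expr0 mul1r.
congr (_ + _ + _); last by rewrite linearZ [in RHS]exprS mulN1r scaleNr.
rewrite -sumrN; apply: eq_bigr => j _.
rewrite linearZ -scaleNr [in RHS]wordS [nat_of_ord (lift _ _)]/= /bump add1n exprS mulN1r mulNr.
congr (- _ *: _).
have -> : lift (lift ord0 j) (ord0 : 'I_m.+2.-1) = ord0 by apply: val_inj.
congr (B _ _); apply: eq_word => i z; congr (B _ _).
by apply: val_inj; rewrite /= /bump; lia.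
Qed.

Definition submodule (T : V -> Prop) :=
  (forall u v, T u -> T v -> T (u + v)) /\ (forall a u, T u -> T (a *: u)).

Lemma submodule0 T u : submodule T -> T u -> T 0.
Proof. by case=> _ TZ /(TZ 0); rewrite scale0r. Qed.

Lemma submodule_sum T (J : finType) (u : J -> V) :
  submodule T -> T 0 -> (forall j, T (u j)) -> T (\sum_j u j).
Proof. by move=> [TD TZ] T0 Tu; elim/big_ind: _ => //; apply: TD. Qed.

(** Each [A i] removes at most one [B j], so every term of the full expansion still begins with some
    [B j]. *)
Lemma rword_word_lt p q (A : 'I_p -> {linear V -> V}) (B : 'I_q -> {linear V -> V})
    (g : 'I_p -> 'I_q -> R) T y :
  submodule T -> (forall j z, T (B j z)) ->
  (forall i j z, A i (B j z) = g i j *: z - B j (A i z)) ->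
  (p < q)%N -> T (rword A (word B y)).
Proof.
move=> Tsub; elim: p q A B g y => [|p IH] [|q] A B g y TB AB // lt_pq.
  exact: TB.
rewrite rwordS.
rewrite (word_skip _ (AB ord0)) linearD linear_sum.
have [TD TZ] := Tsub.
have T0 : T 0 by apply: (submodule0 Tsub (TB ord0 0)).
apply: (TD).
  apply: submodule_sum => // j; rewrite linearZ; apply: (TZ).
  by apply: (IH _ _ _ (fun i k => g (lift ord0 i) (lift j k))) => // i k z; rewrite AB.
rewrite linearZ; apply: (TZ).
by apply: (IH _ _ _ (fun i k => g (lift ord0 i) k)) => //; apply: ltnW.
Qed.

(** Laplace expansion modulo [T]. The last hypothesis disposes of the terms in which some [A i]
    reaches [y]; the index families [s] and [t] are arbitrary so that it passes to the cofactors. *)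
Lemma rword_word_det m (A B : 'I_m -> {linear V -> V}) (g : 'M[R]_m) T y :
  submodule T -> T 0 ->
  (forall i j z, A i (B j z) = g i j *: z - B j (A i z)) ->
  (forall p q (s : 'I_p -> 'I_m) (t : 'I_q -> 'I_m) i, (p < q)%N ->
     T (rword (fun i => A (s i)) (word (fun j => B (t j)) (A i y)))) ->
  T (rword A (word B y) - \det g *: y).
Proof.
move=> Tsub T0; have [TD TZ] := Tsub.
elim: m A B g => [|m IH] A B g AB HT.
  by rewrite det_mx00 scale1r subrr.
rewrite rwordS (word_skip _ (AB ord0)) linearD linear_sum.
rewrite (expand_det_row g ord0) scaler_suml addrAC -sumrB.
apply: (TD); last first.
  by rewrite linearZ; apply: (TZ); apply: (HT _ _ (lift ord0) id).
apply: submodule_sum => // j; rewrite linearZ /cofactor [(_ + j)%N]add0n.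
rewrite [X in X *: y]mulrCA [X in X *: y]mulrA -[in X in _ - X]scalerA -scalerBr; apply: (TZ).
apply: IH => [i k z|p q s t i lt_pq]; first by rewrite !mxE.
exact: (HT _ _ (fun i => lift ord0 (s i)) (fun k => lift j (t k))).
Qed.

Lemma rword_word_det0 m (A B : 'I_m -> {linear V -> V}) (g : 'M[R]_m) y :
  (forall i j z, A i (B j z) = g i j *: z - B j (A i z)) ->
  (forall i, A i y = 0) -> rword A (word B y) = \det g *: y.
Proof.
move=> AB Ay; apply/eqP; rewrite -subr_eq0; apply/eqP.
apply: (rword_word_det (T := fun z => z = 0)) => //.
  by split=> [u v -> ->|a u ->]; rewrite ?addr0 ?scaler0.
by move=> p q s t i _; rewrite Ay !linear0.
Qed.

Lemma word_anticomm m (A : {linear V -> V}) (B : 'I_m -> {linear V -> V}) y :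
  (forall j z, A (B j z) = - B j (A z)) -> A (word B y) = (-1) ^+ m *: word B (A y).
Proof.
elim: m B => [|m IH] B AB /=; first by rewrite scale1r.
by rewrite AB IH // linearZ /= exprS mulN1r scaleNr.
Qed.

Lemma word_id m (B : 'I_m -> {linear V -> V}) j y :
  (forall i k z, B i (B k z) = - B k (B i z)) -> (forall i z, B i (B i z) = 0) ->
  word B (B j y) = 0.
Proof.
elim: m B j => [|m IH] B j; first by case: j.
move=> BB B2; rewrite wordS; case: (unliftP ord0 j) => [k|] ->; first by rewrite IH ?linear0.
have := @word_anticomm m (B ord0) (fun i => B (lift ord0 i)) y.
move=> /(_ (fun j z => BB _ _ _)) H.
have /(congr1 (fun z => (-1) ^+ m *: z)) := H.
rewrite scalerA -expr2 sqrr_sign scale1r => <-.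
by rewrite linearZ /= B2 scaler0.
Qed.

End Words.

(** Terms cancel in pairs, an orbit being represented by its element of smaller [enum_rank].
    Doubling may fail to be injective, hence the separate condition at fixed points. *)
Lemma sum_involution (V : zmodType) (T : finType) (t : T -> T) (F : T -> V) :
  involutive t -> (forall x, F (t x) = - F x) -> (forall x, t x = x -> F x = 0) ->
  \sum_x F x = 0.
Proof.
move=> tK Ft F0; pose P x := (enum_rank x < enum_rank (t x))%N.
rewrite (bigID P) /= [X in _ + X](bigID (fun x => t x == x)) /=.
rewrite [X in _ + (X + _)]big1 ?add0r; last by move=> x /andP[_ /eqP /F0].
rewrite [X in _ + X](reindex_inj (inv_inj tK)) /=.
rewrite [X in _ + X](eq_bigl P) => [|x]; last first.
  rewrite /P tK -leqNgt; have [->|ne] := eqVneq (t x) x.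
    by rewrite ltnn andbF.
  by rewrite andbT ltn_neqAle val_eqE (inj_eq enum_rank_inj) eq_sym ne.
by rewrite -big_split big1 //= => x _; rewrite Ft subrr.
Qed.

(** * Finitely generated ideals, regular sequences and grade *)

Section Ideals.
Variable R : comNzRingType.
Implicit Types (I : R -> Prop) (s : seq R).

Lemma ideal_sum I (J : Type) (r : seq J) (P : pred J) (F : J -> R) :
  is_ideal I -> (forall j, P j -> I (F j)) -> I (\sum_(j <- r | P j) F j).
Proof. by move=> [I0 ID _] IF; elim/big_ind: _. Qed.

Lemma idealMr I a x : is_ideal I -> I x -> I (x * a).
Proof. by move=> [_ _ IM] Ix; rewrite mulrC; apply: IM. Qed.

Lemma idealN I x : is_ideal I -> I x -> I (- x).
Proof. by move=> [_ _ IM] Ix; rewrite -mulN1r; apply: IM. Qed.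

Lemma ideal_ofP s : is_ideal (ideal_of s).
Proof.
split=> [|x y [c ->] [d ->]|a x [c ->]].
- by exists (fun=> 0); rewrite big1 // => i _; rewrite mul0r.
- by exists (fun i => c i + d i); rewrite -big_split; apply: eq_bigr => i _; rewrite mulrDl.
- by exists (fun i => a * c i); rewrite mulr_sumr; apply: eq_bigr => i _; rewrite mulrA.
Qed.

Lemma ideal_of_mem s x : x \in s -> ideal_of s x.
Proof.
move=> /(nthP 0) [i lt_i <-]; exists (fun j => (j == Ordinal lt_i)%:R).
rewrite (bigD1 (Ordinal lt_i)) //= eqxx mul1r big1 ?addr0 // => j /negPf->.
by rewrite mul0r.
Qed.

Lemma ideal_of_sub I s x :
  is_ideal I -> (forall y, y \in s -> I y) -> ideal_of s x -> I x.
Proof.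
move=> idI sI [c ->]; apply: ideal_sum => // i _.
by case: idI => _ _; apply; apply/sI/mem_nth.
Qed.

Lemma ideal_of_nil (x : R) : ideal_of [::] x -> x = 0.
Proof. by case=> c ->; rewrite big_ord0. Qed.

(** Coefficients indexed by [nat] keep their type when the size of the list is rewritten. *)
Lemma ideal_of_nat s x : ideal_of s x ->
  exists c : nat -> R, x = \sum_(i < size s) c i * s`_i.
Proof.
case=> c ->; exists (fun i => oapp c 0 (insub i)).
by apply: eq_bigr => i _; rewrite valK.
Qed.

Lemma ideal_of_takeS s k x : (k < size s)%N -> ideal_of (take k.+1 s) x ->
  exists c, ideal_of (take k s) (x - c * s`_k).
Proof.
move=> lt_k /ideal_of_nat[c]; rewrite (take_nth 0) // size_rcons => ->.
exists (c (size (take k s))); rewrite big_ord_recr /= nth_rcons ltnn eqxx addrK.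
by exists c; apply: eq_bigr => i _; rewrite nth_rcons ltn_ord.
Qed.

Lemma ideal_of_take s k x : ideal_of (take k s) x -> ideal_of s x.
Proof.
apply: (ideal_of_sub (I := ideal_of s)); first exact: ideal_ofP.
by move=> y /mem_take; apply: ideal_of_mem.
Qed.

Lemma ideal_of_take_leq s j k x : (j <= k)%N ->
  ideal_of (take j s) x -> ideal_of (take k s) x.
Proof. by move=> le_jk; rewrite -(take_takel s le_jk); apply: ideal_of_take. Qed.

Lemma ideal_of_take_nth s k : (k < size s)%N -> ideal_of (take k.+1 s) s`_k.
Proof.
move=> lt_k; apply: ideal_of_mem.
by rewrite (take_nth 0) // mem_rcons mem_head.
Qed.

Lemma regular_seq_take s k : regular_seq s -> regular_seq (take k s).
Proof.
move=> [reg s1]; split=> [i|/ideal_of_take//].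
rewrite size_take_min leq_min => /andP[lt_ik lt_is] y.
by rewrite take_takel 1?ltnW // nth_take //; apply: reg.
Qed.

Lemma grade_ge_leq I j k : (j <= k)%N -> grade_ge I k -> grade_ge I j.
Proof.
move=> le_jk [I1|[s [sz_s sI reg]]]; [by left | right; exists (take j s)].
split; last exact: regular_seq_take.
  by rewrite size_take_min sz_s; apply/minn_idPl.
by move=> x /mem_take; apply: sI.
Qed.

Lemma grade_ge_sub I J k : (forall x, I x -> J x) -> grade_ge I k -> grade_ge J k.
Proof.
move=> IJ [/IJ|[s [sz_s sI reg]]]; [by left | right; exists s].
by split=> // x /sI /IJ.
Qed.

Lemma regular_seq_head s y : regular_seq s -> (0 < size s)%N -> s`_0 * y = 0 -> y = 0.
Proof.
move=> [reg _] s_gt0 sy; apply: ideal_of_nil; rewrite -(take0 s); apply: reg => //.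
by rewrite sy take0; case: (ideal_ofP [::]).
Qed.

End Ideals.

(** * Determinants and a binomial inequality *)

Lemma odd_involution (T : finType) (t : T -> T) :
  involutive t -> odd #|T| -> exists x, t x = x.
Proof.
move=> tK; have [x /eqP tx _|no] := pickP (fun x => t x == x); first by exists x.
pose P := [set x | (enum_rank x < enum_rank (t x))%N].
have tP : t @: P = ~: P.
  apply/setP => x; rewrite -{1}[x]tK mem_imset ?inE ?tK; last exact: inv_inj.
  by rewrite -leqNgt ltn_neqAle val_eqE (inj_eq enum_rank_inj) no.
by rewrite -(cardsC P) -tP card_imset ?addnn ?odd_double //; apply: inv_inj.
Qed.

(** The terms of a permutation and of its inverse cancel, by the sign [(-1) ^+ k]. A self-inverse
    permutation of an odd set has a fixed point, so its term contains a diagonal entry. No division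
    by 2 occurs. *)
Lemma det_alternating_odd (R : comNzRingType) k (B : 'M[R]_k) :
  (forall i, B i i = 0) -> (forall i j, B i j = - B j i) -> odd k -> \det B = 0.
Proof.
move=> B0 BN odd_k; rewrite /determinant.
apply: (sum_involution (t := fun s : 'S_k => (s^-1)%g)) => [|s|s sV].
- exact: invgK.
- rewrite odd_permV -mulrN; congr (_ * _).
  rewrite (reindex_inj (@perm_inj _ s)) /=.
  under eq_bigr do rewrite permK BN.
  by rewrite prodrN card_ord -signr_odd odd_k mulN1r.
- have sK : involutive s by move=> i; rewrite -{1}sV permK.
  have [|i si] := odd_involution sK; first by rewrite card_ord.
  by rewrite (bigD1 i) //= si B0 mul0r mulr0.
Qed.

Lemma det_congr (R : comNzRingType) (I : R -> Prop) k (A B : 'M[R]_k) :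
  is_ideal I -> (forall i j, I (A i j - B i j)) -> I (\det A - \det B).
Proof.
move=> idI AB; rewrite /determinant -sumrB; apply: ideal_sum => // s _.
rewrite -mulrBr; case: (idI) => I0 ID IM; apply: (IM).
elim/big_ind2: _ => [|x' x y' y Ix Iy|i _]; [by rewrite subrr| |exact: AB].
have -> : x * y - x' * y' = x * (y - y') + y' * (x - x') by ring.
by apply: (ID); apply: (IM).
Qed.

Lemma det_mulmx_thin (R : comNzRingType) p (C : 'M[R]_(p + 1, p)) (M : 'M[R]_(p, p + 1)) :
  \det (C *m M) = 0.
Proof.
(* Padding with a zero column and a zero row gives square factors, for which the determinant is
   multiplicative. *)
have -> : C *m M = row_mx C (0 : 'M_(p + 1, 1)) *m col_mx M 0.
  by rewrite mul_row_col mul0mx addr0.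
rewrite det_mulmx.
rewrite (expand_det_col _ (rshift p ord0)) big1 ?mul0r // => i _.
by rewrite row_mxEr mxE mul0r.
Qed.

Lemma bin_gt (n r : nat) : (2 <= r)%N -> (r.+2 <= n)%N -> (n < 'C(n, r))%N.
Proof.
move=> r_ge2; elim: n => // n IH; rewrite ltnS leq_eqVlt => /predU1P[<-|lt_rn].
  have <- : 'C(r.+2, r.+2 - 2) = 'C(r.+2, r) by rewrite !subSS subn0.
  rewrite bin_sub // bin2 -divn2 leq_divRL //; nia.
case: r r_ge2 lt_rn IH => // r r_ge2 lt_rn IH; rewrite binS -addn1.
apply: leq_add; first by apply: IH.
by rewrite bin_gt0; lia.
Qed.

(** * The radical of an ideal *)

Section Radical.
Variables (R : comNzRingType) (I : R -> Prop).
Hypothesis idI : is_ideal I.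

Definition radical x := exists N, I (x ^+ N).

Lemma radicalP : is_ideal radical.
Proof.
have [I0 ID IM] := idI; split=> [|x y [M Ix] [N Iy]|a x [N Ix]].
- by exists 1%N.
- exists (M + N)%N; rewrite exprDn; apply: ideal_sum => // i _.
  rewrite -mulr_natl; apply: (IM); have [le_iN|lt_Ni] := leqP i N.
    by rewrite -addnBA // exprD; do 2?apply: idealMr => //.
  by rewrite -[X in y ^+ X](subnK (ltnW lt_Ni)) exprD mulrA; apply: (IM).
- by exists N; rewrite exprMn; apply: IM.
Qed.

Lemma sub_radical x : I x -> radical x.
Proof. by exists 1%N; rewrite expr1. Qed.

Lemma radical_exp x N : radical (x ^+ N) -> radical x.
Proof. by case=> M; rewrite -exprM; exists (N * M)%N. Qed.

End Radical.

(** * The exterior algebra of a free module: wedge and contraction *)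

Section Exterior.
Variables (R : comNzRingType) (n : nat).

(** The value at [S] is the coefficient of [e_S], the product of the basis vectors indexed by [S] in
    increasing order; one free module holds all degrees. *)
Definition ext := {ffun {set 'I_n} -> R^o}.
HB.instance Definition _ := GRing.Lmodule.on ext.
Implicit Types (y z : ext) (x u : 'I_n -> R) (S T : {set 'I_n}) (i j : 'I_n).

(** The sign acquired when [e_i] moves from the left end to its place in [e_S]; it is the same for
    [S] with or without [i]. *)
Definition sg i S : R := (-1) ^+ #|[set j in S | (j < i)%N]|.

Definition wedge x y : ext :=
  [ffun S : {set 'I_n} => \sum_(i in S) sg i S * x i * (y (S :\ i) : R)].

Definition contract u y : ext :=
  [ffun S : {set 'I_n} => \sum_(i | i \notin S) sg i S * u i * (y (i |: S) : R)].

Lemma extD y z S : (y + z) S = (y S : R) + (z S : R).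
Proof. by rewrite ffunE. Qed.
Lemma extN y S : (- y) S = - (y S : R). Proof. by rewrite ffunE. Qed.
Lemma extB y z S : (y - z) S = (y S : R) - (z S : R).
Proof. by rewrite extD extN. Qed.
Lemma extZ (a : R) y S : (a *: y) S = a * (y S : R). Proof. by rewrite ffunE. Qed.
Lemma ext0 S : (0 : ext) S = 0 :> R. Proof. by rewrite ffunE. Qed.
Lemma ext_sum (J : finType) (P : pred J) (y : J -> ext) S :
  (\sum_(j | P j) y j) S = \sum_(j | P j) (y j S : R).
Proof. by rewrite sum_ffunE. Qed.

Lemma wedge_is_linear x : linear (wedge x).
Proof.
move=> a y z; apply/ffunP => S; rewrite extD extZ !ffunE mulr_sumr -big_split.
by apply: eq_bigr => i _; rewrite extD extZ /=; ring.
Qed.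
HB.instance Definition _ x :=
  GRing.isLinear.Build R ext ext _ (wedge x) (wedge_is_linear x).

Lemma contract_is_linear u : linear (contract u).
Proof.
move=> a y z; apply/ffunP => S; rewrite extD extZ !ffunE mulr_sumr -big_split.
by apply: eq_bigr => i _; rewrite extD extZ /=; ring.
Qed.
HB.instance Definition _ u :=
  GRing.isLinear.Build R ext ext _ (contract u) (contract_is_linear u).

Lemma sgU1 i j S : j \notin S -> sg i (j |: S) = (-1) ^+ (j < i)%N * sg i S.
Proof.
move=> jS; rewrite /sg -exprD; case: ltnP => ji.
  rewrite (_ : [set k in j |: S | (k < i)%N] = j |: [set k in S | (k < i)%N]).
    by rewrite cardsU1 inE (negPf jS).
  by apply/setP => k; rewrite !inE; case: eqP => [->|//]; rewrite ji.
rewrite add0n; congr (_ ^+ #|pred_of_set _|); apply/setP => k; rewrite !inE.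
by case: eqP => [->|//]; rewrite (negPf jS) ltnNge ji.
Qed.

Lemma sgD1 i j S : j \in S -> sg i (S :\ j) = (-1) ^+ (j < i)%N * sg i S.
Proof.
move=> jS; rewrite -{2}(setD1K jS) sgU1 ?setD11 // mulrA -expr2 sqrr_sign.
by rewrite mul1r.
Qed.

Lemma sg2 i S : sg i S * sg i S = 1.
Proof. by rewrite -expr2 sqrr_sign. Qed.

Lemma sign_ltn_neq i j : i != j ->
  (-1) ^+ (j < i)%N = - (-1) ^+ (i < j)%N :> R.
Proof. by case: (ltngtP i j) => [||/val_inj->]; rewrite ?eqxx //= ?opprK. Qed.

Lemma wedge2E x x' y S : wedge x (wedge x' y) S =
  \sum_(i in S) \sum_(j in S | j != i)
     (-1) ^+ (i < j)%N * (sg i S * sg j S) * (x i * x' j) * (y (S :\ i :\ j) : R) :> R.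
Proof.
rewrite ffunE; apply: eq_bigr => i iS; rewrite ffunE mulr_sumr.
apply: eq_big => [j|j]; first by rewrite !inE andbC.
by rewrite !inE => /andP[ji jS]; rewrite sgD1 //; ring.
Qed.

Lemma wedge_anticomm x x' y : wedge x (wedge x' y) = - wedge x' (wedge x y).
Proof.
apply/ffunP => S; rewrite extN !wedge2E -sumrN (exchange_big_dep (mem S)) /=.
  apply: eq_bigr => j jS; rewrite -sumrN; apply: eq_big => [i|i /and3P[iS _ ji]].
    by rewrite jS eq_sym.
  rewrite (sign_ltn_neq ji) (_ : S :\ i :\ j = S :\ j :\ i); first by ring.
  by apply/setP => k; rewrite !inE andbCA.
by move=> i j _ /andP[].
Qed.

(** Anticommutation gives only twice the claim; instead the terms of [(i, j)] and [(j, i)]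
    cancel. *)
Lemma wedge_id x y : wedge x (wedge x y) = 0.
Proof.
apply/ffunP => S; rewrite ext0 wedge2E pair_big_dep /= big_mkcond /=.
apply: (sum_involution (t := fun p => (p.2, p.1))) => [[i j] //|[i j]|[i j]] /=.
  rewrite [i == j]eq_sym andbCA; case: (i \in S); last by rewrite ?andbF oppr0.
  case: (j \in S) => /=; last by rewrite ?andbF oppr0.
  have [_|ji] /= := eqVneq j i; first by rewrite oppr0.
  rewrite (sign_ltn_neq ji) (_ : S :\ i :\ j = S :\ j :\ i); first by ring.
  by apply/setP => k; rewrite !inE andbCA.
by case=> ->; rewrite eqxx !andbF.
Qed.

Definition dot x u : R := \sum_i x i * u i.

Lemma contract_wedge u x y :
  contract u (wedge x y) = dot x u *: y - wedge x (contract u y).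
Proof.
apply/ffunP => S; rewrite extB extZ [contract _ _ _]ffunE [wedge _ _ _]ffunE.
(* The term in which [e_i], [i] outside [S], is contracted and [e_j], [j] in [S], is multiplied; it
   enters the two products with opposite signs. The diagonal terms, outside [S] from one product and
   inside [S] from the other, add up to [dot x u]. *)
pose F i j : R := sg i S * sg j S * (-1) ^+ (i < j)%N * u i * x j * (y (i |: S :\ j) : R).
have -> : \sum_(i | i \notin S) sg i S * u i * (wedge x y (i |: S) : R) =
   \sum_(i | i \notin S) x i * u i * (y S : R) + \sum_(i | i \notin S) \sum_(j in S) F i j.
  rewrite -big_split; apply: eq_bigr => i iS; rewrite ffunE big_setU1 //= mulrDr.
  congr (_ + _).
    by rewrite sgU1 // ltnn expr0 setU1K // -[RHS]mul1r -[in RHS](sg2 i S); ring.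
  rewrite mulr_sumr; apply: eq_bigr => j jS; rewrite /F sgU1 //.
  rewrite (_ : (i |: S) :\ j = i |: S :\ j); first by ring.
  apply/setP => k; rewrite !inE; have [->|] := eqVneq k i; last by rewrite orFb.
  by rewrite andbT orTb; apply: contraNneq iS => ->.
have -> : \sum_(j in S) sg j S * x j * (contract u y (S :\ j) : R) =
   \sum_(j in S) x j * u j * (y S : R) - \sum_(j in S) \sum_(i | i \notin S) F i j.
  rewrite -sumrN -big_split; apply: eq_bigr => j jS /=.
  rewrite ffunE (bigD1 j) /= ?setD11 // mulrDr; congr (_ + _).
    by rewrite setD1K // sgD1 // ltnn expr0 mul1r -[RHS]mul1r -[in RHS](sg2 j S); ring.
  rewrite mulr_sumr -sumrN; apply: eq_big => [i|i].
    by rewrite !inE; have [->|] := eqVneq i j; rewrite ?jS ?andbT //= andbF.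
  by rewrite !inE => /andP[_ ij]; rewrite /F sgD1 // (sign_ltn_neq ij); ring.
rewrite [X in _ = _ - (_ - X)]exchange_big /=.
by rewrite /dot mulr_suml [X in _ = X - _](bigID (mem S)) /=; ring.
Qed.

Definition basis S : ext := [ffun T => (T == S)%:R].
Definition unitv i : 'I_n -> R := fun j => (j == i)%:R.

Lemma basisE S T : basis S T = (T == S)%:R :> R. Proof. by rewrite ffunE. Qed.

Lemma ext_basis y : y = \sum_S (y S : R) *: basis S.
Proof.
apply/ffunP => T; rewrite ext_sum (bigD1 T) //= extZ basisE eqxx mulr1.
by rewrite big1 ?addr0 // => S ST; rewrite extZ basisE eq_sym (negPf ST) mulr0.
Qed.

Lemma dot_unitv x i : dot x (unitv i) = x i.
Proof.
rewrite /dot (bigD1 i) //= /unitv eqxx mulr1 big1 ?addr0 // => j /negPf->.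
by rewrite mulr0.
Qed.

Lemma wedge_unitvE i y S :
  wedge (unitv i) y S = (if i \in S then sg i S * (y (S :\ i) : R) else 0) :> R.
Proof.
rewrite ffunE; case: ifPn => iS.
  rewrite (bigD1 i) //= /unitv eqxx mulr1 big1 ?addr0 // => j /andP[_ /negPf->].
  by rewrite mulr0 mul0r.
rewrite big1 // => j jS; rewrite /unitv; case: eqP jS iS => [-> -> //|_ _ _].
by rewrite mulr0 mul0r.
Qed.

Lemma contract_unitvE i y S :
  contract (unitv i) y S = (if i \in S then 0 else sg i S * (y (i |: S) : R)) :> R.
Proof.
rewrite ffunE; case: ifPn => iS.
  rewrite big1 // => j jS; rewrite /unitv; case: eqP jS iS => [-> /negPf-> //|_ _ _].
  by rewrite mulr0 mul0r.
rewrite (bigD1 i) //= /unitv eqxx mulr1 big1 ?addr0 // => j /andP[_ /negPf->].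
by rewrite mulr0 mul0r.
Qed.

Lemma wedge_unitv_basis i S : i \notin S ->
  wedge (unitv i) (basis S) = sg i S *: basis (i |: S).
Proof.
move=> iS; apply/ffunP => T; rewrite extZ wedge_unitvE !basisE.
have [->|neT] := eqVneq T (i |: S).
  by rewrite setU11 setU1K // eqxx sgU1 // ltnn mul1r.
rewrite mulr0; case: ifP => // iT; case: eqP => [eqS|]; last by rewrite mulr0.
by rewrite -eqS setD1K ?eqxx in neT.
Qed.

Lemma wedge_unitv_basis0 i S : i \in S -> wedge (unitv i) (basis S) = 0.
Proof.
move=> iS; apply/ffunP => T; rewrite ext0 wedge_unitvE basisE.
case: ifP => // iT; case: eqP => [eqS|]; last by rewrite mulr0.
by rewrite -eqS setD11 in iS.
Qed.

Lemma contract_unitv_basis0 i S : i \notin S -> contract (unitv i) (basis S) = 0.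
Proof.
move=> iS; apply/ffunP => T; rewrite ext0 contract_unitvE basisE.
case: ifP => // iT; case: eqP => [eqS|]; last by rewrite mulr0.
by rewrite -eqS setU11 in iS.
Qed.

Lemma basis_set1U i S : i \in S ->
  basis S = sg i S *: wedge (unitv i) (basis (S :\ i)).
Proof.
move=> iS; rewrite wedge_unitv_basis ?setD11 // setD1K // scalerA sgD1 //.
by rewrite ltnn mul1r sg2 scale1r.
Qed.

Definition wedges k (X : 'I_k -> 'I_n -> R) y : ext :=
  word (fun a : 'I_k => wedge (X a) : {linear ext -> ext}) y.
Definition contracts k (f : 'I_k -> 'I_n) y : ext :=
  rword (fun a : 'I_k => contract (unitv (f a)) : {linear ext -> ext}) y.
HB.instance Definition _ k (X : 'I_k -> 'I_n -> R) :=
  GRing.isLinear.Build R ext ext _ (wedges X) (word_is_linear _).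
HB.instance Definition _ k (f : 'I_k -> 'I_n) :=
  GRing.isLinear.Build R ext ext _ (contracts f) (rword_is_linear _).

Lemma wedgesS k (X : 'I_k.+1 -> 'I_n -> R) y :
  wedges X y = wedge (X ord0) (wedges (fun a : 'I_k => X (lift ord0 a)) y).
Proof. by []. Qed.

Lemma eq_wedges k (X X' : 'I_k -> 'I_n -> R) y :
  (forall a : 'I_k, X a =1 X' a) -> wedges X y = wedges X' y.
Proof.
move=> eqX; apply: eq_word => i z; apply/ffunP => S; rewrite !ffunE.
by apply: eq_bigr => j _; rewrite eqX.
Qed.

Lemma wedge_wedges k (X : 'I_k -> 'I_n -> R) x y :
  wedge x (wedges X y) = (-1) ^+ k *: wedges X (wedge x y).
Proof. by apply: word_anticomm => j z; apply: wedge_anticomm. Qed.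

Lemma wedges_id k (X : 'I_k -> 'I_n -> R) (j : 'I_k) y : wedges X (wedge (X j) y) = 0.
Proof.
apply: (word_id (B := fun a : 'I_k => wedge (X a) : {linear ext -> ext})) => [i l z|i z] /=.
  exact: wedge_anticomm.
exact: wedge_id.
Qed.

Lemma wedge_wedges_id k (X : 'I_k -> 'I_n -> R) (j : 'I_k) y : wedge (X j) (wedges X y) = 0.
Proof. by rewrite wedge_wedges wedges_id scaler0. Qed.

Lemma contract_wedges k (X : 'I_k -> 'I_n -> R) u y : (forall j : 'I_k, dot (X j) u = 0) ->
  contract u (wedges X y) = (-1) ^+ k *: wedges X (contract u y).
Proof.
move=> Xu; apply: word_anticomm => j z /=.
by rewrite contract_wedge Xu scale0r add0r.
Qed.

(** * Exterior elements modulo an ideal *)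

Definition cin (I : R -> Prop) y := forall S, I (y S).

Section Cin.
Variables (I : R -> Prop) (idI : is_ideal I).

Lemma cin0 : cin I 0. Proof. by move=> S; rewrite ext0; case: idI. Qed.
Lemma cinD y z : cin I y -> cin I z -> cin I (y + z).
Proof. by move=> Iy Iz S; rewrite extD; case: idI => _ ID _; apply: ID. Qed.
Lemma cinZ a y : cin I y -> cin I (a *: y).
Proof. by move=> Iy S; rewrite extZ; case: idI => _ _; apply. Qed.
Lemma cinZl a y : I a -> cin I (a *: y).
Proof. by move=> Ia S; rewrite extZ; apply: idealMr. Qed.
Lemma cinN y : cin I y -> cin I (- y).
Proof. by move=> Iy; rewrite -scaleN1r; apply: cinZ. Qed.
Lemma cinB y z : cin I y -> cin I z -> cin I (y - z).
Proof. by move=> Iy Iz; apply: cinD => //; apply: cinN. Qed.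
Lemma cin_sum (J : finType) (y : J -> ext) :
  (forall a : J, cin I (y a)) -> cin I (\sum_a y a).
Proof. by move=> Iy S; rewrite ext_sum; apply: ideal_sum => // a _; apply: Iy. Qed.

Lemma cin_wedge x y : cin I y -> cin I (wedge x y).
Proof.
move=> Iy S; rewrite ffunE; apply: ideal_sum => // i _.
by case: idI => _ _; apply; apply: Iy.
Qed.

Lemma cin_wedgel x y : (forall i, I (x i)) -> cin I (wedge x y).
Proof.
move=> Ix S; rewrite ffunE; apply: ideal_sum => // i _.
by apply: idealMr => //; case: idI => _ _; apply; apply: Ix.
Qed.

Lemma cin_wedges k (X : 'I_k -> 'I_n -> R) y : cin I y -> cin I (wedges X y).
Proof.
elim: k X y => [|k IH] X y Iy //; rewrite wedgesS.
by apply: cin_wedge; apply: IH.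
Qed.

Lemma cin_contract u y : cin I y -> cin I (contract u y).
Proof.
move=> Iy S; rewrite ffunE; apply: ideal_sum => // i _.
by case: idI => _ _; apply; apply: Iy.
Qed.

Lemma cin_contracts k (f : 'I_k -> 'I_n) y : cin I y -> cin I (contracts f y).
Proof.
elim: k f y => [|k IH] f y Iy //; apply: (IH (fun a : 'I_k => f (lift ord0 a))).
exact: cin_contract.
Qed.

(** [basis set0] is the unit. Every [basis S] is, up to sign, a product of unit vectors, and these
    move to the left of the rows at the cost of signs. *)
Lemma cin_wedges_basis0 k (X : 'I_k -> 'I_n -> R) y :
  cin I (wedges X (basis set0)) -> cin I (wedges X y).
Proof.
move=> IX; rewrite (ext_basis y) linear_sum /=; apply: cin_sum => S.
rewrite linearZ; apply: cinZ; move eqd: #|S| => d.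
elim: d S eqd => [|d IH] S; first by move/eqP; rewrite cards_eq0 => /eqP->.
move=> eqd; have /card_gt0P[i iS] : (0 < #|S|)%N by rewrite eqd.
rewrite (basis_set1U iS) linearZ /=; apply: cinZ.
have := wedge_wedges X (unitv i) (basis (S :\ i)).
move/(congr1 (fun z => (-1) ^+ k *: z)).
rewrite scalerA -expr2 sqrr_sign scale1r => <-; apply: cinZ; apply: cin_wedge.
by apply: IH; move: eqd; rewrite (cardsD1 i) iS => -[].
Qed.

End Cin.

(* [homog e p y]: [y] is homogeneous of degree [p - e]; the offset avoids
   truncated subtraction, so that [y = 0] when [p < e]. *)
Definition homcomp (e p : nat) y : ext :=
  [ffun S : {set 'I_n} => if (#|S| + e == p)%N then y S else 0].
Definition homog (e p : nat) y := homcomp e p y = y.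

Lemma homcompE e p y S :
  homcomp e p y S = (if (#|S| + e == p)%N then (y S : R) else 0) :> R.
Proof. by rewrite ffunE. Qed.

Lemma homcomp_is_linear e p : linear (homcomp e p).
Proof.
move=> a y z; apply/ffunP => S; rewrite extD extZ !homcompE extD extZ.
by case: ifP => _; rewrite ?mulr0 ?addr0.
Qed.
HB.instance Definition _ e p :=
  GRing.isLinear.Build R ext ext _ (homcomp e p) (homcomp_is_linear e p).

Lemma homcomp_homog e p y : homog e p (homcomp e p y).
Proof. by apply/ffunP => S; rewrite !homcompE; case: eqP. Qed.

Lemma homog_eq0 e p y S : homog e p y -> (#|S| + e)%N != p -> y S = 0 :> R.
Proof. by move=> <- /negPf neq; rewrite homcompE neq. Qed.

Lemma homog_lt0 e p y : homog e p y -> (p < e)%N -> y = 0.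
Proof.
move=> hy lt_pe; apply/ffunP => S; rewrite ext0 (homog_eq0 hy) //.
by apply: contraTneq lt_pe => <-; rewrite -leqNgt leq_addl.
Qed.

Lemma homog0 e p : homog e p 0. Proof. exact: linear0. Qed.
Lemma homogZ e p a y : homog e p y -> homog e p (a *: y).
Proof. by move=> hy; rewrite /homog linearZ /= hy. Qed.
Lemma homogB e p y z : homog e p y -> homog e p z -> homog e p (y - z).
Proof. by move=> hy hz; rewrite /homog linearB /= hy hz. Qed.

Lemma homogSS e p y : homog e.+1 p.+1 y <-> homog e p y.
Proof.
suff eqc : homcomp e.+1 p.+1 y = homcomp e p y by rewrite /homog eqc.
by apply/ffunP => S; rewrite !homcompE addnS eqSS.
Qed.

Lemma homog_addn e p k y : homog (e + k) (p + k) y <-> homog e p y.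
Proof.
elim: k => [|k IH]; first by rewrite !addn0; split.
by rewrite !addnS; split=> [/homogSS /IH //|/IH hy]; apply/homogSS.
Qed.

Lemma homog_basis e S : homog e (#|S| + e) (basis S).
Proof.
apply/ffunP => T; rewrite homcompE basisE; have [->|_] := eqVneq T S.
  by rewrite eqxx.
by case: ifP.
Qed.

Lemma homcomp_wedge e p x y : homcomp e p (wedge x y) = wedge x (homcomp e.+1 p y).
Proof.
apply/ffunP => S; rewrite homcompE [in RHS]ffunE.
transitivity (\sum_(i in S) (if (#|S| + e == p)%N then sg i S * x i * (y (S :\ i) : R) else 0)).
  by case: ifP => _; [rewrite ffunE | rewrite big1].
apply: eq_bigr => i iS; rewrite homcompE (cardsD1 i S) iS addnS add1n addSn.
by case: ifP => //; rewrite mulr0.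
Qed.

Lemma homcomp_contract e p u y :
  homcomp e.+1 p (contract u y) = contract u (homcomp e p y).
Proof.
apply/ffunP => S; rewrite homcompE [in RHS]ffunE.
transitivity (\sum_(i | i \notin S)
  (if (#|S| + e.+1 == p)%N then sg i S * u i * (y (i |: S) : R) else 0)).
  by case: ifP => _; [rewrite ffunE | rewrite big1].
apply: eq_bigr => i iS; rewrite homcompE cardsU1 iS addnS add1n addSn.
by case: ifP => //; rewrite mulr0.
Qed.

Lemma homcomp_wedges e p k (X : 'I_k -> 'I_n -> R) y :
  homcomp e p (wedges X y) = wedges X (homcomp (e + k) p y).
Proof.
elim: k e X => [|k IH] e X; first by rewrite addn0.
by rewrite !wedgesS homcomp_wedge IH addSnnS.
Qed.

Lemma contractsS k (f : 'I_k.+1 -> 'I_n) y :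
  contracts f y = contracts (fun a : 'I_k => f (lift ord0 a)) (contract (unitv (f ord0)) y).
Proof. by []. Qed.

Lemma eq_contracts k (f g : 'I_k -> 'I_n) y : f =1 g -> contracts f y = contracts g y.
Proof.
elim: k f g y => [|k IH] f g y eqfg //.
by rewrite !contractsS eqfg; apply: IH => a; apply: eqfg.
Qed.

Lemma homog_wedge e p x y : homog e.+1 p y -> homog e p (wedge x y).
Proof. by rewrite /homog homcomp_wedge => ->. Qed.
Lemma homog_wedges e p k (X : 'I_k -> 'I_n -> R) y :
  homog (e + k) p y -> homog e p (wedges X y).
Proof. by rewrite /homog homcomp_wedges => ->. Qed.
Lemma homog_contract e p u y : homog e p y -> homog e.+1 p (contract u y).
Proof. by rewrite /homog homcomp_contract => ->. Qed.

Lemma homog_top y : homog 0 n y -> (y setT : R) = 0 -> y = 0.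
Proof.
move=> hy y0; apply/ffunP => S; rewrite ext0; have [->//|neS] := eqVneq S setT.
rewrite (homog_eq0 hy) // addn0; apply: contraNneq neS => eqn.
by rewrite eqEcard subsetT cardsT card_ord eqn leqnn.
Qed.

Lemma cin_homcomp I e p y : is_ideal I -> cin I y -> cin I (homcomp e p y).
Proof.
by move=> [I0 _ _] Iy S; rewrite homcompE; case: ifP => // _; apply: Iy.
Qed.

Lemma contracts_coef k (f : 'I_k -> 'I_n) S :
  exists a : R, forall y, contracts f y S = a * (y (S :|: [set f i | i : 'I_k]) : R).
Proof.
elim: k f => [|k IH] f.
  exists 1 => y; rewrite mul1r; congr (y _); apply/setP => j; rewrite !inE.
  by case: imsetP => [[[]]|_] //; rewrite orbF.
have [a Ha] := IH (fun b : 'I_k => f (lift ord0 b)).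
set T := S :|: _ in Ha.
exists (a * (if f ord0 \in T then 0 else sg (f ord0) T)) => y.
rewrite contractsS Ha.
rewrite contract_unitvE; case: ifP => _; rewrite ?mulr0 ?mul0r // mulrA.
congr (_ * y _); apply/setP => j; rewrite !inE orbCA; congr (_ || _).
apply/idP/idP => [/orP[/eqP->|/imsetP[b _ ->]]|/imsetP[b _ ->]]; try exact: imset_f.
case: (unliftP ord0 b) => [c|] ->; last by rewrite eqxx.
by apply/orP; right; apply/imsetP; exists c.
Qed.

Lemma contracts_eq0 k (f : 'I_k -> 'I_n) (a : 'I_k) y S :
  f a \in S -> contracts f y S = 0 :> R.
Proof.
elim: k f a y => [|k IH] f a y; first by case: a.
rewrite contractsS.
case: (unliftP ord0 a) => [c ->|-> fS]; first exact: IH.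
have [b ->] := contracts_coef (fun b : 'I_k => f (lift ord0 b)) S.
by rewrite contract_unitvE !inE fS mulr0.
Qed.

Lemma coef_contracts k S : #|S| = k ->
  exists (f : 'I_k -> 'I_n) (a : R), forall y, y S = a * (contracts f y set0 : R).
Proof.
elim: k S => [|k IH] S.
  move/eqP; rewrite cards_eq0 => /eqP->.
  by exists (fun a : 'I_0 => match a with Ordinal _ h => match notF h with end end), 1
     => y; rewrite mul1r.
move=> eqk; have /card_gt0P[i iS] : (0 < #|S|)%N by rewrite eqk.
have [|f [a Ha]] := IH (S :\ i); first by move: eqk; rewrite (cardsD1 i) iS => -[].
exists (fun b : 'I_k.+1 => oapp f i (unlift ord0 b)), (sg i (S :\ i) * a) => y.
rewrite contractsS unlift_none /= -mulrA.
rewrite (eq_contracts (g := f)) => [|b]; last by rewrite liftK.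
rewrite -Ha contract_unitvE setD11 setD1K // mulrA sgD1 // ltnn mul1r sg2.
by rewrite mul1r.
Qed.

(** * Maximal minors as coefficients of products of rows *)

Lemma minor_rows_mem k (X : 'M[R]_(k, n)) (f : 'I_k -> 'I_n) :
  ideal_of (maxminors_rows X) (\det (colsub f X)).
Proof.
apply: ideal_of_mem; apply/imageP; exists (finfun f) => //.
by congr (\det _); apply/matrixP => a b; rewrite !mxE ffunE.
Qed.

Lemma ideal_of_minors_rows k (X : 'M[R]_(k, n)) (I : R -> Prop) e : is_ideal I ->
  (forall f : 'I_k -> 'I_n, I (\det (colsub f X))) ->
  ideal_of (maxminors_rows X) e -> I e.
Proof. by move=> idI IX; apply: ideal_of_sub => // y /imageP[f _ ->]. Qed.

Lemma contract_wedge_unitv k (X : 'M[R]_(k, n)) (f : 'I_k -> 'I_n) (a b : 'I_k) z :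
  contract (unitv (f a)) (wedge (X b) z) =
  (colsub f X)^T a b *: z - wedge (X b) (contract (unitv (f a)) z).
Proof. by rewrite contract_wedge dot_unitv !mxE. Qed.

Lemma contracts_wedges_det k (X : 'M[R]_(k, n)) (f : 'I_k -> 'I_n) y :
  (forall a : 'I_k, contract (unitv (f a)) y = 0) ->
  contracts f (wedges X y) = \det (colsub f X) *: y.
Proof.
move=> fy; rewrite -det_tr; apply: rword_word_det0 => // a b z.
exact: contract_wedge_unitv.
Qed.

Lemma cin_minors k (X : 'M[R]_(k, n)) y : cin (ideal_of (maxminors_rows X)) (wedges X y).
Proof.
apply: cin_wedges_basis0; first exact: ideal_ofP.
move=> S; have [eqk|neqk] := eqVneq #|S| k.
  have [f [a ->]] := coef_contracts eqk.
  rewrite contracts_wedges_det => [|b]; last by rewrite contract_unitv_basis0 ?inE.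
  by rewrite extZ basisE eqxx mulr1; case: (ideal_ofP (maxminors_rows X)) => _ _; apply;
     apply: minor_rows_mem.
rewrite (@homog_eq0 0 k _ S) ?addn0 //; first by case: (ideal_ofP (maxminors_rows X)).
by apply: homog_wedges; have := homog_basis k set0; rewrite cards0.
Qed.

(** Multiply the rows by [e_D], with [D] the complement of the image of [f], and contract along [f]:
    the coefficient at [D] is the minor, and it is also a multiple of the top coefficient before
    contraction. *)
Lemma minor_top k (X : 'M[R]_(k, n)) (f : 'I_k -> 'I_n) : exists a : R,
  \det (colsub f X) = a * (wedges X (basis (~: [set f b | b : 'I_k])) setT : R).
Proof.
set D := ~: _; have [a Ha] := contracts_coef f D; exists a.
have := Ha (wedges X (basis D)).
rewrite contracts_wedges_det => [|b]; last first.
  by rewrite contract_unitv_basis0 // inE negbK imset_f.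
by rewrite extZ basisE eqxx mulr1 setUC setUCr.
Qed.

Lemma rword_wedges k (X : 'I_k -> 'I_n -> R) y : exists a : R,
  rword (fun b : 'I_k => wedge (X b) : {linear ext -> ext}) y = wedges X (a *: y).
Proof.
elim: k X y => [|k IH] X y; first by exists 1; rewrite scale1r.
have [a /= ->] := IH (fun b => X (lift ord0 b)) (wedge (X ord0) y).
exists (a * (-1) ^+ k); rewrite wedgesS wedge_wedges !linearZ /= linearZ /=.
by rewrite scalerA mulrCA -expr2 sqrr_sign mulr1.
Qed.

(** The roles of wedge and contraction are exchanged: [y] is first contracted, then multiplied by
    the rows. Since the rows kill [y], the determinant formula has no error term. *)
Lemma minor_annihilated k (X : 'M[R]_(k, n)) e y :
  (forall a : 'I_k, wedge (X a) y = 0) -> ideal_of (maxminors_rows X) e ->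
  exists z, e *: y = wedges X z.
Proof.
move=> Xy; apply: (ideal_of_minors_rows (I := fun c => exists z, c *: y = wedges X z)) => [|f].
  split=> [|u v [z Hz] [z' Hz']|u v [z Hz]].
  - by exists 0; rewrite scale0r linear0.
  - by exists (z + z'); rewrite scalerDl Hz Hz' linearD.
  - by exists (u *: z); rewrite -scalerA Hz linearZ.
pose A (a : 'I_k) : {linear ext -> ext} := wedge (X a).
pose B (a : 'I_k) : {linear ext -> ext} := contract (unitv (f a)).
have AB a b z : A a (B b z) = colsub f X a b *: z - B b (A a z).
  by rewrite /A /B /= contract_wedge dot_unitv mxE opprB addrC subrK.
rewrite -(rword_word_det0 AB Xy).
by have [a ->] := rword_wedges X (word B y); eexists.
Qed.

(** * The left ideal generated by the rows *)

Definition modrows (J : R -> Prop) k (X : 'I_k -> 'I_n -> R) y :=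
  exists b : 'I_k -> ext, cin J (y - \sum_a wedge (X a) (b a)).

Section Modrows.
Variables (J : R -> Prop) (idJ : is_ideal J).

Lemma modrows_submodule k (X : 'I_k -> 'I_n -> R) : submodule (modrows J X).
Proof.
split=> [y z [b Hb] [c Hc]|e y [b Hb]].
  exists (fun a => b a + c a); under eq_bigr do rewrite linearD.
  by rewrite big_split opprD addrACA; apply: cinD.
exists (fun a => e *: b a); under eq_bigr do rewrite linearZ.
by rewrite -scaler_sumr -scalerBr; apply: cinZ.
Qed.

Lemma modrows_cin k (X : 'I_k -> 'I_n -> R) y : cin J y -> modrows J X y.
Proof.
move=> Jy; exists (fun=> 0); rewrite big1 ?subr0 // => a _; exact: linear0.
Qed.

Lemma modrows_wedge k (X : 'I_k -> 'I_n -> R) (a : 'I_k) y : modrows J X (wedge (X a) y).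
Proof.
exists (fun b => if b == a then y else 0); rewrite (bigD1 a) //= eqxx big1.
  by rewrite addr0 subrr; apply: (cin0 idJ).
by move=> b /negPf->; rewrite linear0.
Qed.

(** [rword_word_det] with [T] the left ideal of the rows modulo [J]: when contractions are fewer
    than wedges, a wedge survives in front. *)
Lemma contracts_wedges_modrows k (X : 'M[R]_(k, n)) (f : 'I_k -> 'I_n) y :
  modrows J X (contracts f (wedges X y) - \det (colsub f X) *: y).
Proof.
have sub := modrows_submodule X.
pose A (a : 'I_k) : {linear ext -> ext} := contract (unitv (f a)).
pose B (a : 'I_k) : {linear ext -> ext} := wedge (X a).
have AB a b z : A a (B b z) = (colsub f X)^T a b *: z - B b (A a z).
  exact: contract_wedge_unitv.
rewrite -det_tr; apply: (rword_word_det (A := A) (B := B) sub) => //.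
  by apply: modrows_cin; apply: cin0.
move=> p q s t a lt_pq.
apply: (rword_word_lt (g := fun c d => (colsub f X)^T (s c) (t d))) => //.
by move=> c z; apply: modrows_wedge.
Qed.

(** The division lemma up to a factor from the ideal of minors; regularity later cancels the
    factor. *)
Lemma minor_modrows k (X : 'M[R]_(k, n)) e y :
  cin J (wedges X y) -> ideal_of (maxminors_rows X) e -> modrows J X (e *: y).
Proof.
have [subD subZ] := modrows_submodule X => JXy.
apply: (ideal_of_minors_rows (I := fun c => modrows J X (c *: y))) => [|f].
  split=> [|u v Hu Hv|u v Hu].
  - by rewrite scale0r; apply: modrows_cin; apply: cin0.
  - by rewrite scalerDl; apply: subD.
  - by rewrite -scalerA; apply: subZ.
have /(subZ (-1)) := contracts_wedges_modrows X f y.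
rewrite scaleN1r opprB => /subD /(_ (modrows_cin X (cin_contracts idJ f JXy))).
by rewrite subrK.
Qed.

End Modrows.

Lemma modrows_homog J k (X : 'I_k -> 'I_n -> R) p y : is_ideal J ->
  homog 0 p y -> modrows J X y ->
  exists b : 'I_k -> ext, (forall a : 'I_k, homog 1 p (b a)) /\
    cin J (y - \sum_a wedge (X a) (b a)).
Proof.
move=> idJ hy [b Hb]; exists (fun a => homcomp 1 p (b a)); split=> [a|].
  exact: homcomp_homog.
move/(cin_homcomp 0 p idJ): Hb; rewrite linearB linear_sum /= hy.
by under eq_bigr do rewrite homcomp_wedge.
Qed.

Lemma minors_row' k (X : 'M[R]_(k.+1, n)) e :
  ideal_of (maxminors_rows X) e -> ideal_of (maxminors_rows (row' ord0 X)) e.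
Proof.
have idI := ideal_ofP (maxminors_rows (row' ord0 X)).
apply: (ideal_of_minors_rows idI) => f.
rewrite (expand_det_row _ ord0); apply: ideal_sum => // j _; rewrite /cofactor.
case: (idI) => _ _ IM; apply: (IM); apply: (IM).
have -> : row' ord0 (col' j (colsub f X)) = colsub (fun l => f (lift j l)) (row' ord0 X).
  by apply/matrixP => c d; rewrite !mxE.
exact: minor_rows_mem.
Qed.

Lemma wedges_row' k (X : 'M[R]_(k.+1, n)) y :
  wedges X y = wedge (X ord0) (wedges (row' ord0 X) y).
Proof. by rewrite wedgesS; congr wedge; apply: eq_wedges => j l; rewrite mxE. Qed.

(** * Division with respect to a regular sequence of minors *)

Section Division.
Variable a : seq R.
Hypothesis reg : forall s, (s < size a)%N -> forall t,
  ideal_of (take s a) (a`_s * t) -> ideal_of (take s a) t.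

Let J s := ideal_of (take s a).

Let idJ s : is_ideal (J s). Proof. exact: ideal_ofP. Qed.

Let cinJ_leq s y : cin (J s) y -> cin (J s.+1) y.
Proof. by move=> Jy S; apply: ideal_of_take_leq (Jy S). Qed.

Let cinJ_reg s y : (s < size a)%N -> cin (J s) (a`_s *: y) -> cin (J s) y.
Proof. by move=> lt_s Jy S; apply: reg => //; rewrite -extZ; apply: Jy. Qed.

Let cinJ_nth s y : (s < size a)%N -> cin (J s.+1) (a`_s *: y).
Proof. by move=> lt_s; apply: cinZl => //; apply: ideal_of_take_nth. Qed.

Lemma cin_takeS s y : (s < size a)%N -> cin (J s.+1) y ->
  exists d : ext, cin (J s) (y - a`_s *: d).
Proof.
move=> lt_s Jy.
have /fin_all_exists[d Hd] : forall S, exists c, J s ((y S : R) - c * a`_s).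
  by move=> S; apply: ideal_of_takeS (Jy S).
by exists [ffun S : {set 'I_n} => d S] => S; rewrite extB extZ ffunE mulrC.
Qed.

Let in_minors k (X : 'M[R]_(k, n)) :=
  forall e, e \in a -> ideal_of (maxminors_rows X) e.

(** Raising the degree by one costs one element of the sequence, and so does each element already
    divided out; hence the bound on [p + s]. *)
Let divides p := forall s k (X : 'M[R]_(k, n)) y, (p + s < size a)%N ->
  in_minors X -> homog 0 p y -> cin (J s) (wedges X y) ->
  exists b : 'I_k -> ext, (forall j : 'I_k, homog 1 p (b j)) /\
    cin (J s) (y - \sum_j wedge (X j) (b j)).

(* (x) \cap a_s E is contained in a_s (x) modulo (a_0, ..., a_{s-1}). *)
Lemma rows_cap p : divides p -> forall k (X : 'M[R]_(k, n)) s (b : 'I_k -> ext),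
  (p.+1 + s < size a)%N -> in_minors X ->
  (forall j : 'I_k, homog 1 p.+1 (b j)) ->
  cin (J s.+1) (\sum_j wedge (X j) (b j)) ->
  exists d : 'I_k -> ext,
    cin (J s) (\sum_j wedge (X j) (b j) - a`_s *: \sum_j wedge (X j) (d j)).
Proof.
move=> divp; elim=> [|k IH] X s b lt_ps minX hb Jz.
  by exists b; rewrite !big_ord0 scaler0 subrr; apply: cin0.
have lt_s : (s < size a)%N by apply: leq_trans lt_ps; rewrite ltnS leq_addl.
pose x (l : 'I_k) : 'I_n -> R := X (lift ord0 l).
have xE (l : 'I_k) : row' ord0 X l =1 x l by move=> c; rewrite mxE.
(* Multiplication by the other rows kills every summand but that of row 0. *)
have Jb0 : cin (J s.+1) (wedges X (b ord0)).
  move: (cin_wedges (idJ _) (row' ord0 X) Jz); rewrite big_ord_recl linearD linear_sum /=.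
  rewrite [X in _ + X]big1 => [|l _]; last first.
    have -> : wedge (X (lift ord0 l)) (b (lift ord0 l)) =
              wedge (row' ord0 X l) (b (lift ord0 l)).
      by apply/ffunP => S; rewrite !ffunE; apply: eq_bigr => c _; rewrite xE.
    exact: wedges_id.
  rewrite addr0 wedges_row' wedge_wedges; exact: cinZ.
(* [b ord0] has degree [p], and [p + s.+1 = p.+1 + s]: division applies modulo one more element of
   the sequence. *)
have [||c [hc Jq]] := divp s.+1 k.+1 X (b ord0) _ minX _ Jb0.
- by move: lt_ps; rewrite addSnnS.
- by apply/homogSS.
set q := _ - _ in Jq; have [d0 Hd0] := cin_takeS lt_s Jq.
(* On substituting for [b ord0], the square of row 0 vanishes and the mixed products are absorbed
   into [b'], leaving one row fewer. *)
pose b' (l : 'I_k) : ext := b (lift ord0 l) - wedge (X ord0) (c (lift ord0 l)).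
have Ez : \sum_j wedge (X j) (b j) = wedge (X ord0) q + \sum_l wedge (row' ord0 X l) (b' l).
  rewrite /q linearB linear_sum /= [in LHS]big_ord_recl -addrA; congr (_ + _).
  rewrite [X in - X + _]big_ord_recl wedge_id add0r -sumrN -big_split /=.
  apply: eq_bigr => l _; rewrite -wedge_anticomm.
  have eqw z : wedge (row' ord0 X l) z = wedge (X (lift ord0 l)) z.
    by apply/ffunP => S; rewrite !ffunE; apply: eq_bigr => e _; rewrite xE.
  by rewrite eqw /b' linearB /= addrC subrK.
have [||||d Hd] := IH (row' ord0 X) s b'.
- by [].
- by move=> e /minX; apply: minors_row'.
- move=> l; apply: homogB => //; apply/homogSS; apply: homog_wedge.
  exact: hc.
- rewrite (_ : \sum_l _ = \sum_j wedge (X j) (b j) - wedge (X ord0) q).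
    by apply: cinB => //; apply: cin_wedge.
  by rewrite Ez addrC addKr.
exists (fun j : 'I_k.+1 => oapp d d0 (unlift ord0 j)).
rewrite Ez [in X in _ *: X]big_ord_recl unlift_none /=.
rewrite (_ : \sum_(i < k) wedge (X (lift ord0 i)) _ = \sum_l wedge (row' ord0 X l) (d l)).
  rewrite scalerDr opprD addrACA -linearZ -linearB /=.
  by apply: cinD => //; apply: cin_wedge.
apply: eq_bigr => l _; rewrite liftK /=.
by apply/ffunP => S; rewrite !ffunE; apply: eq_bigr => e _; rewrite xE.
Qed.

(* Saito's generalization of the de Rham division lemma. *)
Lemma division p : divides p.
Proof.
elim: p => [|p IH] s k X y lt_ps minX hy JXy.
all: have lt_s : (s < size a)%N by apply: leq_ltn_trans lt_ps; rewrite leq_addl.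
all: have mina := minX _ (mem_nth 0 lt_s).
(* The element a_s lies in the ideal of minors, so a_s y is in the left ideal of the rows modulo
   [J s]; it remains to cancel a_s. *)
all: have [b [hb Hb]] := modrows_homog (idJ s) (homogZ a`_s hy) (minor_modrows (idJ s) JXy mina).
  exists b; split=> //; apply: cinJ_reg => //; move: Hb.
  (* In degree 0 the [b j] have degree -1, hence vanish. *)
  by rewrite big1 ?subr0 // => j _; rewrite (homog_lt0 (hb j)) // linear0.
(* The sum over the rows is congruent to a_s y, hence 0 modulo [J s.+1]; [rows_cap] takes a_s out of
   it within the left ideal. *)
have [|d Hd] := rows_cap IH lt_ps minX hb.
  rewrite -[X in cin _ X](subKr (a`_s *: y)).
  by apply: cinB => //; [apply: cinJ_nth | apply: cinJ_leq].
apply: modrows_homog => //; exists d; apply: cinJ_reg => //.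
rewrite scalerBr -(subrK (\sum_j wedge (X j) (b j)) (a`_s *: y)) -addrA.
exact: cinD.
Qed.

(** By [minor_annihilated], a_0 w is the product of the rows with some [u]. Division modulo a_0
    writes [u] as a_0 t plus an element of the left ideal, which the product of the rows kills; then
    a_0 is cancelled. *)
Lemma annihilated_factor k (X : 'M[R]_(k, n)) p w :
  in_minors X -> (p.+1 < size a + k)%N -> (0 < size a)%N -> homog 0 p w ->
  (forall j : 'I_k, wedge (X j) w = 0) ->
  exists t, homog k p t /\ w = wedges X t.
Proof.
move=> minX lt_p a_gt0 hw Xw.
have mina := minX _ (mem_nth 0 a_gt0).
have J0 y : cin (J 0) y -> y = 0.
  move=> Jy; apply/ffunP => S; rewrite ext0; apply: ideal_of_nil.
  by rewrite -(take0 a); apply: Jy.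
have [u0 Hu0] := minor_annihilated Xw mina; pose u := homcomp k p u0.
have Hu : a`_0 *: w = wedges X u.
  have <- : homcomp 0 p (wedges X u0) = wedges X u by apply: homcomp_wedges.
  by rewrite -Hu0 linearZ /= hw.
have [lt_pk|le_kp] := ltnP p k.
  exists 0; split; first exact: homog0.
  rewrite linear0; apply: J0; apply: cinJ_reg => //; rewrite Hu.
  by rewrite [u](homog_lt0 (homcomp_homog k p u0)) // linear0; apply: cin0.
have hu : homog 0 (p - k)%N u.
  by apply/(homog_addn 0 _ k); rewrite subnK //; apply: homcomp_homog.
have [||b [hb Hb]] := @division (p - k)%N 1 k X u _ minX hu.
- by rewrite addn1 ltnNge; apply: contraL lt_p; rewrite -leqNgt; lia.
- by rewrite -Hu; apply: cinJ_nth.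
have [t0 Ht0] := cin_takeS a_gt0 Hb.
have Ht : w = wedges X t0.
  apply/eqP; rewrite -subr_eq0; apply/eqP/J0/cinJ_reg => //.
  rewrite scalerBr Hu -linearZ /= -linearB /=.
  have -> : wedges X (u - a`_0 *: t0) =
            wedges X (u - \sum_j wedge (X j) (b j) - a`_0 *: t0).
    rewrite addrAC [in RHS]linearB /= linear_sum /= [X in _ = _ - X]big1 ?subr0 // => j _.
    exact: wedges_id.
  exact: cin_wedges.
exists (homcomp k p t0); split; first exact: homcomp_homog.
by rewrite -{1}hw {1}Ht; apply: homcomp_wedges.
Qed.

End Division.

(** * Hodge duals and inclusions between ideals of minors *)

Lemma wedgeZl (e : R) x y : wedge (fun i => e * x i) y = e *: wedge x y.
Proof.
apply/ffunP => S; rewrite extZ !ffunE mulr_sumr.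
by apply: eq_bigr => i _; ring.
Qed.

Lemma wedge_basisT x : wedge x (basis setT) = 0.
Proof.
apply/ffunP => S; rewrite ext0 ffunE big1 // => i _; rewrite basisE.
case: eqP => [eqT|]; last by rewrite mulr0.
by have := in_setT i; rewrite -eqT setD11.
Qed.

Lemma contract_basis u T :
  contract u (basis T) = \sum_(i in T) (sg i T * u i) *: basis (T :\ i).
Proof.
apply/ffunP => S; rewrite ext_sum ffunE [LHS]big_mkcond [RHS]big_mkcond /=.
apply: eq_bigr => i _; rewrite extZ !basisE.
have [iT|iT] := boolP (i \in T); last first.
  case: ifP => // _; case: eqP => [eqT|]; last by rewrite mulr0.
  by rewrite -eqT setU11 in iT.
case: ifPn => [iS|]; last first.
  rewrite negbK => iS; case: eqP => [eqS|]; last by rewrite mulr0.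
  by rewrite eqS setD11 in iS.
have -> : (i |: S == T) = (S == T :\ i).
  by apply/eqP/eqP => [<-|->]; [rewrite setU1K | rewrite setD1K].
case: eqP => [->|_]; last by rewrite !mulr0.
by rewrite sgD1 // ltnn mul1r.
Qed.

Lemma contract_basisT v i : contract v (basis setT) (~: [set i]) = sg i setT * v i :> R.
Proof.
rewrite contract_basis ext_sum (bigD1 i) ?inE //= extZ basisE setTD eqxx mulr1.
rewrite big1 ?addr0 // => j ji; rewrite extZ basisE setTD.
case: eqP => [/setP/(_ i)|]; last by rewrite mulr0.
by move: ji; rewrite !inE eqxx /= eq_sym => /negPf->.
Qed.

(** [contract v (basis setT)] is the Hodge dual of [v], of degree n - 1; each row multiplies it to
    [dot (X j) v] times the volume, which is 0. The bound in [annihilated_factor] reads n < (n - k +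
    1) + k. *)
Lemma kernel_factor k (X : 'M[R]_(k, n)) (a : seq R) v :
  (0 < n)%N -> (k <= n)%N -> size a = (n - k).+1 -> regular_seq a ->
  (forall e, e \in a -> ideal_of (maxminors_rows X) e) ->
  (forall j : 'I_k, dot (X j) v = 0) ->
  exists t, homog k n.-1 t /\ contract v (basis setT) = wedges X t.
Proof.
move=> n_gt0 le_kn sz_a [reg _] minX Xv.
apply: (annihilated_factor reg) => //; rewrite ?sz_a //; first by lia.
  apply/(homog_addn 0 _ 1); rewrite !addn1 (prednK n_gt0); apply: homog_contract.
  by have := homog_basis 0 setT; rewrite cardsT card_ord addn0.
move=> j; have := contract_wedge v (X j) (basis setT).
by rewrite wedge_basisT linear0 Xv scale0r sub0r => /esym/eqP; rewrite oppr_eq0 => /eqP.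
Qed.

Lemma kernel_coef k (X : 'M[R]_(k, n)) v t i :
  contract v (basis setT) = wedges X t -> ideal_of (maxminors_rows X) (v i).
Proof.
move=> Hv; have := cin_minors X t (~: [set i]); rewrite -Hv contract_basisT => Iv.
rewrite -[v i]mul1r -(sg2 i setT) -mulrA.
by case: (ideal_ofP (maxminors_rows X)) => _ _; apply.
Qed.

(* The Hodge dual of x_0 /\ ... /\ x_(k-1). *)
Definition covolume k (X : 'I_k -> 'I_n -> R) : ext :=
  [ffun S : {set 'I_n} => wedges X (basis S) setT].

Lemma covolumeE k (X : 'I_k -> 'I_n -> R) S :
  covolume X S = (wedges X (basis S) setT : R) :> R.
Proof. by rewrite ffunE. Qed.

(** By adjointness the coefficient at [T] is, up to sign, a top coefficient of a contraction by [v],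
    and a contraction has none. *)
Lemma wedge_covolume k (X : 'I_k -> 'I_n -> R) v :
  (forall j : 'I_k, dot (X j) v = 0) -> wedge v (covolume X) = 0.
Proof.
move=> Xv; apply/ffunP => T; rewrite ext0.
have -> : wedge v (covolume X) T = wedges X (contract v (basis T)) setT :> R.
  rewrite contract_basis linear_sum ext_sum ffunE; apply: eq_bigr => i _.
  by rewrite covolumeE linearZ /= extZ.
have := contract_wedges (basis T) Xv.
move/(congr1 (fun y => (-1) ^+ k *: y)); rewrite scalerA -expr2 sqrr_sign scale1r => <-.
by rewrite extZ ffunE big1 ?mulr0 // => i; rewrite in_setT.
Qed.

Lemma homog_covolume k (X : 'I_k -> 'I_n -> R) : (k <= n)%N -> homog 0 (n - k) (covolume X).
Proof.
move=> le_kn; apply/ffunP => S; rewrite homcompE addn0 covolumeE.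
case: eqP => // neq; apply/esym.
apply: (@homog_eq0 0 (#|S| + k)); last by rewrite cardsT card_ord; lia.
by apply: homog_wedges; apply/homog_addn; have := homog_basis 0 S; rewrite addn0.
Qed.

Lemma minor_covolume k (X : 'M[R]_(k, n)) (I : R -> Prop) :
  is_ideal I -> cin I (covolume X) -> forall e, ideal_of (maxminors_rows X) e -> I e.
Proof.
move=> idI IX e; apply: ideal_of_minors_rows => // f.
have [a ->] := minor_top X f; case: (idI) => _ _; apply.
by rewrite -covolumeE; apply: IX.
Qed.

(** The rows of [Y] annihilate the covolume of [X], which is therefore a multiple of their product
    and has its coefficients in the ideal of minors of [Y]. *)
Lemma minors_sub k l (X : 'M[R]_(k, n)) (Y : 'M[R]_(l, n)) (a : seq R) :
  (k <= n)%N -> (n - k < (size a).-1 + l)%N -> (0 < size a)%N -> regular_seq a ->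
  (forall e, e \in a -> ideal_of (maxminors_rows Y) e) ->
  (forall (i : 'I_k) (j : 'I_l), dot (X i) (Y j) = 0) ->
  forall e, ideal_of (maxminors_rows X) e -> ideal_of (maxminors_rows Y) e.
Proof.
move=> le_kn lt_sz a_gt0 [reg _] minY XY; apply: minor_covolume; first exact: ideal_ofP.
have [||||| t [_ ->]] := @annihilated_factor a reg l Y (n - k)%N (covolume X) => //.
- by move: lt_sz a_gt0; lia.
- exact: homog_covolume.
- by move=> j; apply: wedge_covolume.
exact: cin_minors.
Qed.

(** [e] times the covolume of [X] is a multiple of the product of the [l] rows of [Y], but has
    degree n - k < l, so it vanishes. *)
Lemma minors_eq0 k l (X : 'M[R]_(k, n)) (Y : 'M[R]_(l, n)) :
  (k <= n)%N -> (n - k < l)%N ->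
  (forall (i : 'I_k) (j : 'I_l), dot (X i) (Y j) = 0) ->
  forall d e, ideal_of (maxminors_rows X) d -> ideal_of (maxminors_rows Y) e -> d * e = 0.
Proof.
move=> le_kn lt_l XY d e Id Ie.
have Xw (j : 'I_l) : wedge (Y j) (covolume X) = 0 by apply: wedge_covolume.
have [z Hz] := minor_annihilated Xw Ie.
have {}Hz : e *: covolume X = 0.
  rewrite -(homog_covolume X le_kn) -linearZ /= Hz homcomp_wedges.
  by rewrite [homcomp _ _ _](homog_lt0 (homcomp_homog _ _ _)) // linear0.
apply: (minor_covolume (X := X) (I := fun c => c * e = 0)) Id.
  split=> [|u v Hu Hv|u v Hv]; first by rewrite mul0r.
    by rewrite mulrDl Hu Hv addr0.
  by rewrite -mulrA Hv mulr0.
by move=> S; rewrite mulrC -extZ Hz ext0.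
Qed.

(** The rows times [y] have top degree, with coefficient in the ideal of minors, hence of the form
    [dot c v]; up to sign, the rows times [wedge c t] give the same. The product of the rows kills
    the difference, and division applies. *)
Lemma top_forms k (X : 'M[R]_(k, n)) (a : seq R) v t y :
  (0 < k)%N -> (k <= n)%N -> size a = (n - k).+1 -> regular_seq a ->
  (forall e, e \in a -> ideal_of (maxminors_rows X) e) ->
  homog k n.-1 t -> contract v (basis setT) = wedges X t ->
  (forall e, ideal_of (maxminors_rows X) e -> exists c, e = dot c v) ->
  homog 0 (n - k) y ->
  exists (c : 'I_n -> R) (b : 'I_k -> ext), y = wedge c t + \sum_j wedge (X j) (b j).
Proof.
move=> k_gt0 le_kn sz_a [reg _] minX ht Hv span hy.
have [c Hc] := span _ (cin_minors X y setT).
have Ht : wedge c (wedges X t) = dot c v *: basis setT.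
  have := contract_wedge v c (basis setT).
  rewrite wedge_basisT linear0 Hv => /esym/eqP; rewrite subr_eq0 => /eqP <- //.
(* The sign compensates for moving [c] past the [k] rows. *)
pose c' i := (-1) ^+ k * c i; exists c'.
have Xt : wedges X (wedge c' t) = dot c v *: basis setT.
  by rewrite wedgeZl linearZ /= -wedge_wedges.
have h1t : homog 1 (n - k)%N t.
  by apply/(homog_addn _ _ k.-1); rewrite add1n prednK // (_ : _ + _ = n.-1)%N //; lia.
have hyt : homog 0 (n - k) (y - wedge c' t) by apply: homogB => //; apply: homog_wedge.
have [|||b [_ Hb]] := division reg (s := 0) (X := X) (y := y - wedge c' t) _ _ hyt _.
- by rewrite addn0 sz_a.
- by [].
- rewrite linearB /= Xt [_ - _](_ : _ = 0); first by apply: cin0; apply: ideal_ofP.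
  apply: homog_top.
    rewrite -Xt -linearB /=; apply: homog_wedges.
    by have /(homog_addn 0 _ k) := hyt; rewrite subnK.
  by rewrite extB extZ basisE eqxx mulr1 Hc subrr.
exists b; apply/eqP; rewrite -subr_eq0 opprD addrA; apply/eqP/ffunP => S.
rewrite ext0; apply: ideal_of_nil; have := Hb S; by rewrite take0.
Qed.

(** * Counting ranks when the rows vanish modulo an ideal *)

Lemma wedge_expand x y S :
  wedge x y S = \sum_i x i * (wedge (unitv i) y S : R) :> R.
Proof.
rewrite ffunE [LHS]big_mkcond; apply: eq_bigr => i _.
by rewrite wedge_unitvE; case: ifP => _; [ring | rewrite mulr0].
Qed.

Lemma wedge_set1 x y i : wedge x y [set i] = x i * (y set0 : R) :> R.
Proof.
rewrite ffunE big_set1 setDv /sg (_ : [set j in [set i] | _] = set0) ?cards0 ?mul1r //.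
by apply/setP => j; rewrite !inE; case: eqP => // ->; rewrite ltnn.
Qed.

(** Modulo [I] the map from [c] to [wedge c t] is onto degree [r]. With n + 1 sets of size [r], the
    identity of size n + 1 would factor through size n modulo [I], and determinants would give 1 in
    [I]. *)
Lemma card_sets_le k (X : 'M[R]_(k, n)) (I : R -> Prop) r t :
  is_ideal I -> ~ I 1 -> (forall (j : 'I_k) i, I (X j i)) ->
  (forall y, homog 0 r y ->
     exists (c : 'I_n -> R) (b : 'I_k -> ext), y = wedge c t + \sum_j wedge (X j) (b j)) ->
  ('C(n, r) <= n)%N.
Proof.
move=> idI I1 IX span; rewrite leqNgt; apply/negP.
have <- : #|[set S : {set 'I_n} | #|S| == r]| = 'C(n, r).
  by rewrite card_draws card_ord.
set D := [set _ | _] => lt_n.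
have le_n : (n + 1 <= #|D|)%N by rewrite addn1.
pose S (a : 'I_(n + 1)) : {set 'I_n} := enum_val (widen_ord le_n a).
have /fin_all_exists[c Hc] : forall a : 'I_(n + 1), exists c : 'I_n -> R,
    forall b : 'I_(n + 1), I ((a == b)%:R - \sum_i c i * (wedge (unitv i) t (S b) : R)).
  move=> a; have [|c [b Hb]] := span (basis (S a)).
    have := enum_valP (widen_ord le_n a); rewrite inE => /eqP <-.
    by have := homog_basis 0 (S a); rewrite addn0.
  exists c => b'; have := congr1 (fun y : ext => y (S b') : R) Hb.
  rewrite basisE extD wedge_expand => /eqP.
  rewrite -subr_eq0 opprD addrA subr_eq0 => /eqP.
  have -> : (S b' == S a) = (a == b').
    by rewrite (inj_eq enum_val_inj) eq_sym -!val_eqE.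
  move=> ->; apply: (cin_sum idI) => j; apply: cin_wedgel => // i.
have := det_congr (A := 1%:M) (B := (\matrix_(a < n + 1, i < n) c a i) *m
        (\matrix_(i < n, b < n + 1) (wedge (unitv i) t (S b) : R))) idI.
rewrite det1 det_mulmx_thin subr0 => H; apply/I1/H => a b.
rewrite !mxE; have := Hc a b; congr (I (_ - _)); apply: eq_bigr => i _.
by rewrite !mxE.
Qed.

(** * Parity of the corank *)

Definition cons_rows k x (Y : 'M[R]_(k, n)) : 'M[R]_(k.+1, n) :=
  \matrix_(i < k.+1, j < n) oapp (fun l => Y l j) (x j) (unlift ord0 i).

Lemma wedges_cons_rows k x (Y : 'M[R]_(k, n)) y :
  wedges (cons_rows x Y) y = wedge x (wedges Y y).
Proof.
rewrite wedgesS (eq_wedges (X' := Y)) => [|a j]; last by rewrite mxE liftK.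
by apply/ffunP => S; rewrite !ffunE; apply: eq_bigr => i _; rewrite mxE unlift_none.
Qed.

(** Over a field, [Y] would span a space of dimension k - 1 containing the rows. Here independence
    means that the product is nonzero modulo [Q], and [Y] grows by the new row if this keeps the
    product nonzero, else by a unit vector. *)
Lemma independent_completion (Q : R -> Prop) k (X : 'M[R]_(k, n)) :
  is_ideal Q -> ~ Q 1 -> (k <= n)%N ->
  ~ cin Q (wedges X (basis set0)) \/
  exists k' (Y : 'M[R]_(k', n)), [/\ k = k'.+1, ~ cin Q (wedges Y (basis set0)) &
    forall j : 'I_k, cin Q (wedge (X j) (wedges Y (basis set0)))].
Proof.
move=> idQ Q1; elim: k X => [|k IH] X le_kn.
  by left => /(_ set0); rewrite basisE eqxx.
have rowE (l : 'I_k) z : wedge (X (lift ord0 l)) z = wedge (row' ord0 X l) z.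
  by apply/ffunP => S; rewrite !ffunE; apply: eq_bigr => i _; rewrite mxE.
have [indep|[k' [Y [Ek indep HY]]]] := IH (row' ord0 X) (ltnW le_kn).
  have [dep|] := classic (cin Q (wedges X (basis set0))); last by left.
  right; exists k, (row' ord0 X); split=> // j.
  case: (unliftP ord0 j) => [l|] ->; last by rewrite -wedges_row'.
  by rewrite rowE wedge_wedges_id; apply: cin0.
right; exists k'.+1.
have [dep|indep0] := classic (cin Q (wedge (X ord0) (wedges Y (basis set0)))); last first.
  exists (cons_rows (X ord0) Y); rewrite wedges_cons_rows; split=> [|//|j]; first by rewrite Ek.
  case: (unliftP ord0 j) => [l|] ->; last by rewrite wedge_id; apply: cin0.
  by rewrite wedge_anticomm rowE; apply: cinN => //; apply: cin_wedge.
(* [S] carries a coefficient outside [Q] and has k' < n elements; a unit vector with index outside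
   [S] keeps the product nonzero modulo [Q]. *)
have [S /= HS] := not_all_ex_not _ _ indep.
have cardS : #|S| = k'.
  have hY : homog 0 k' (wedges Y (basis set0)).
    by apply: homog_wedges; have := homog_basis k' set0; rewrite cards0.
  apply/eqP/negPn/negP => neq; apply: HS.
  by rewrite (homog_eq0 hY) ?addn0 //; case: idQ.
have [i iS] : exists i, i \notin S.
  have : (0 < #|~: S|)%N by rewrite cardsCs setCK card_ord cardS; lia.
  by case/card_gt0P => i; rewrite inE; exists i.
exists (cons_rows (unitv i) Y); rewrite wedges_cons_rows; split; first by rewrite Ek.
  move=> /(_ (i |: S)); rewrite wedge_unitvE setU11 setU1K // => QS; apply: HS.
  rewrite -[X in Q X]mul1r -(sg2 i (i |: S)) -mulrA.
  by case: idQ => _ _; apply.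
move=> j; rewrite wedge_anticomm; apply: cinN => //; apply: cin_wedge => //.
case: (unliftP ord0 j) => [l|] -> //.
by rewrite rowE.
Qed.

Lemma zero_ideal : is_ideal (fun e : R => e = 0).
Proof. by split=> // [x y -> ->|a x ->]; rewrite ?addr0 ?mulr0. Qed.

(** Cramer's rule: the minor times [c] is, modulo the rows of [Y], a combination of unit vectors
    outside the columns [f]. Its coefficients are read off in degree 1 from the contraction along
    [f] of the rows times [c]. *)
Lemma cramer_expand k (Y : 'M[R]_(k, n)) (f : 'I_k -> 'I_n) (c : 'I_n -> R) :
  exists (g : 'I_n -> R) (e : 'I_k -> R), (forall a : 'I_k, g (f a) = 0) /\
    forall y, \det (colsub f Y) *: wedge c y =
      \sum_i g i *: wedge (unitv i) y - \sum_a e a *: wedge (Y a) y.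
Proof.
have [b Hb] := contracts_wedges_modrows zero_ideal Y f (wedge c (basis set0)).
exists (fun i => contracts f (wedges Y (wedge c (basis set0))) [set i]).
exists (fun a => b a set0); split=> [a|y].
  by rewrite (contracts_eq0 (a := a)) // inE.
set h := \det _; pose g i : R := contracts f (wedges Y (wedge c (basis set0))) [set i].
have Hg i : g i = h * c i + \sum_a Y a i * (b a set0 : R).
  have := Hb [set i]; rewrite !extB extZ wedge_set1 basisE eqxx mulr1 ext_sum => /eqP.
  rewrite subr_eq0 subr_eq -/(g i) => /eqP ->; rewrite addrC; congr (_ + _).
  by apply: eq_bigr => a _; rewrite wedge_set1.
apply/eqP; rewrite eq_sym subr_eq; apply/eqP.
apply/ffunP => S; rewrite extD extZ !ext_sum wedge_expand mulr_sumr.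
transitivity (\sum_i (h * (c i * (wedge (unitv i) y S : R)) +
     \sum_a (b a set0 : R) * (Y a i * (wedge (unitv i) y S : R)))).
  apply: eq_bigr => i _; rewrite extZ -/(g i) Hg mulrDl mulrA; congr (_ + _).
  by rewrite mulr_suml; apply: eq_bigr => a _; ring.
rewrite big_split; congr (_ + _); rewrite exchange_big; apply: eq_bigr => a _.
by rewrite extZ wedge_expand mulr_sumr.
Qed.

Lemma odd_corank k (X : 'M[R]_(k, n)) t :
  (0 < k)%N -> (k <= n)%N -> ~ ideal_of (maxminors_rows X) 1 ->
  (forall y, homog 0 (n - k) y ->
     exists (c : 'I_n -> R) (b : 'I_k -> ext), y = wedge c t + \sum_j wedge (X j) (b j)) ->
  odd (n - k).
Proof.
move=> k_gt0 le_kn I1 span; set I := ideal_of _ in I1.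
have idI : is_ideal I by apply: ideal_ofP.
(* In the radical, a power lying in [Q] puts its base in [Q]. *)
pose Q := radical I; have idQ : is_ideal Q by apply: radicalP.
have [Q0 QD QM] := idQ.
have Q1 : ~ Q 1 by case=> N; rewrite expr1n.
have [[] |[k' [Y [Ek indep QXY]]]] := independent_completion X idQ Q1 le_kn.
  by move=> S; apply: sub_radical; apply: cin_minors.
have [f Hf] : exists f : 'I_k' -> 'I_n, ~ Q (\det (colsub f Y)).
  apply: not_all_ex_not => QY; apply: indep => S.
  by apply: (ideal_of_minors_rows idQ QY); apply: cin_minors.
set h := \det _ in Hf.
have [e He] := minor_top Y f; rewrite -/h in He.
set D := ~: _ in He; set h' : R := wedges Y (basis D) setT in He.
have Qh' : ~ Q h' by move=> Qh'; apply: Hf; rewrite He; apply: QM.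
(* A nonzero top coefficient forces the degrees to add up to n; as [k = k'.+1], [D] has (n - k) + 1
   elements. *)
have cardD : (#|D| + k' = n)%N.
  have hD : homog 0 (#|D| + k') (wedges Y (basis D)).
    by apply: homog_wedges; apply: homog_basis.
  apply/eqP/negPn/negP => neq; apply: Qh'; rewrite /h' (homog_eq0 hD) //.
  by rewrite addn0 cardsT card_ord eq_sym.
have nkD : (n - k = #|D| - 1)%N by lia.
pose d (a : 'I_#|D|) : 'I_n := enum_val a.
have dD a : d a \in D := enum_valP a.
have d_inj : injective d := enum_val_inj.
have Qrow u (j : 'I_k) w : cin Q (wedges Y (wedge u (wedge (X j) w))).
  rewrite wedge_anticomm linearN /=; apply: cinN => //.
  have := wedge_wedges Y (X j) (wedge u w).
  move/(congr1 (fun y => (-1) ^+ k' *: y)); rewrite scalerA -expr2 sqrr_sign scale1r => <-.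
  apply: cinZ => //; rewrite -wedges_cons_rows; apply: cin_wedges_basis0 => //.
  by rewrite wedges_cons_rows; apply: QXY.
(* These are dual to the unit vectors indexed by [D], with values in multiples of [basis D]. *)
pose y (a : 'I_#|D|) : ext := sg (d a) D *: basis (D :\ d a).
have hy a : homog 0 (n - k) (y a).
  apply: homogZ; have := homog_basis 0 (D :\ d a).
  by rewrite addn0 cardsDS ?sub1set // cards1 nkD.
have wy a b : wedge (unitv (d b)) (y a) = (a == b)%:R *: basis D.
  rewrite linearZ /=; have [->|ab] := eqVneq a b.
    by rewrite scale1r -basis_set1U.
  by rewrite scale0r wedge_unitv_basis0 ?scaler0 // in_setD1 dD (inj_eq d_inj) eq_sym ab.
have /fin_all_exists[c /fin_all_exists[b Hc]] := fun a => span _ (hy a).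
(* An alternating form; [formP] will show that the [c a] are dual to the unit vectors of [D] up to
   the factor [h'], modulo [Q]. *)
pose form u v : R := wedges Y (wedge v (wedge u t)) setT.
have formP a a' : Q (form (c a) (unitv (d a')) - (a == a')%:R * h').
  have -> : (a == a')%:R * h' = wedges Y (wedge (unitv (d a')) (y a)) setT.
    by rewrite wy linearZ extZ.
  rewrite Hc !linearD !linear_sum /= extD opprD addrA subrr sub0r.
  by apply: idealN => //; apply: (cin_sum idQ) => j; apply: Qrow.
have /fin_all_exists[g /fin_all_exists[l Hg]] := fun a => cramer_expand Y f (c a).
pose B := \matrix_(a, a') form (unitv (d a)) (unitv (d a')).
pose G := \matrix_(a, a') g a (d a').
(* Row [a] of [G] holds the coordinates of [h] times [c a] on [D], modulo the rows of [Y], which the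
   form kills. *)
have GB a a' : (G *m B) a a' = h * form (c a) (unitv (d a')).
  have [g0 gE] := Hg a.
  have := congr1 (fun w => wedges Y (wedge (unitv (d a')) w) setT : R) (gE t).
  rewrite !(linearZ, linearB) /= extZ -/h -/(form _ _) => ->.
  rewrite extB !linear_sum /= !ext_sum [X in _ - X]big1 ?subr0 => [|i _].
    rewrite (bigID (mem D)) /= [X in _ + X]big1 ?addr0 => [|i iD].
      rewrite mxE [RHS](reindex d) /=; last first.
        exists (enum_rank_in (dD a)) => i iD; rewrite ?enum_valK_in //.
        exact: enum_rankK_in.
      apply: eq_big => [i|i _]; first by rewrite dD.
      by rewrite !mxE !linearZ /= extZ.
    move: iD; rewrite inE negbK => /imsetP[s _ ->]; rewrite g0 scale0r !linear0.
    exact: ext0.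
  rewrite !linearZ /= extZ wedge_anticomm linearN /= extN wedges_id ext0.
  by rewrite oppr0 mulr0.
(* If n - k is even, [B] is alternating of odd size and [\det B = 0], while [G *m B] is congruent to
   the scalar matrix [h * h']; so a power of [h * h'] lies in [Q]. *)
apply: contraPT Hf => even_r; apply.
have B0 : \det B = 0.
  apply: det_alternating_odd => [i|i j|]; rewrite ?mxE.
  - by rewrite /form wedge_id linear0 ext0.
  - by rewrite /form wedge_anticomm linearN /= extN.
  - by move: even_r; rewrite nkD oddB ?addbT ?negbK //; lia.
have := det_congr (A := G *m B) (B := (h * h')%:M) idQ.
rewrite det_mulmx B0 mulr0 det_scalar sub0r => Hdet.
have QN : Q ((h * h') ^+ #|D|).
  rewrite -[_ ^+ _]opprK; apply: idealN => //; apply: Hdet => a a'.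
  rewrite GB mxE -mulr_natl (_ : _ - _ = h * (form (c a) (unitv (d a')) - (a == a')%:R * h')).
    by apply: QM.
  by ring.
have Qhh : Q (h * h') by apply: radical_exp QN.
(* As [h] is a multiple of [h'], its square is a multiple of [h * h']. *)
apply: (@radical_exp _ _ h 2); rewrite expr2 {2}He mulrCA; exact: QM.
Qed.

End Exterior.

(** * The determinant trick *)

Section MaximalMinors.
Variable R : comNzRingType.

Lemma det_ideal (I : R -> Prop) k (A : 'M[R]_k) :
  is_ideal I -> (0 < k)%N -> (forall i j, I (A i j)) -> I (\det A).
Proof.
case: k A => // k A idI _ IA; rewrite (expand_det_row _ ord0).
by apply: ideal_sum => // j _; apply: idealMr.
Qed.

Lemma det_ideal_square (I T : R -> Prop) k (A : 'M[R]_k) :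
  is_ideal I -> is_ideal T -> (forall x y, I x -> I y -> T (x * y)) ->
  (1 < k)%N -> (forall i j, I (A i j)) -> T (\det A).
Proof.
case: k A => [|[|k]] // A idI idT IIT _ IA; rewrite (expand_det_row _ ord0).
apply: ideal_sum => // j _; apply: IIT => //; rewrite /cofactor.
by case: (idI) => _ _; apply; apply: det_ideal => // i i'; rewrite !mxE.
Qed.

(** The generators lie in the square of the ideal. With [c] the coefficient matrix, [1 - c] kills
    the column of generators, so its determinant kills the ideal; it is congruent to 1 modulo the
    ideal. *)
Lemma determinant_trick (s : seq R) :
  (forall x, x \in s -> exists2 c : 'I_(size s) -> R,
      forall j, ideal_of s (c j) & x = \sum_j c j * s`_j) ->
  exists2 e, ideal_of s e & forall x, ideal_of s x -> e * x = x.
Proof.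
move=> sM; have idI := ideal_ofP s.
have /fin_all_exists2[c Ic Hc] : forall i : 'I_(size s), exists2 c : 'I_(size s) -> R,
      forall j, ideal_of s (c j) & s`_i = \sum_j c j * s`_j.
  by move=> i; apply/sM/mem_nth.
pose A : 'M[R]_(size s) := 1%:M - \matrix_(i, j) c i j.
pose v : 'cV[R]_(size s) := \col_i s`_i.
have Av : A *m v = 0.
  apply/matrixP => i j; rewrite mulmxBl mul1mx !mxE Hc; apply/eqP; rewrite subr_eq0.
  by apply/eqP/eq_bigr => k _; rewrite !mxE.
exists (1 - \det A).
  rewrite -opprB -(@det1 R (size s)); apply: idealN => //; apply: det_congr => // i j.
  by rewrite !mxE addrAC subrr sub0r; apply: idealN.
move=> x; apply: (ideal_of_sub (I := fun x => (1 - \det A) * x = x)).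
  split=> [|y z Hy Hz|y z Hz]; first by rewrite mulr0.
    by rewrite mulrDr Hy Hz.
  by rewrite mulrCA Hz.
move=> y /(nthP 0)[i lt_i <-].
have /matrixP/(_ (Ordinal lt_i) 0) : \det A *: v = 0.
  by rewrite -mul_scalar_mx -mul_adj_mx -mulmxA Av mulmx0.
by rewrite !mxE /= mulrBl mul1r => ->; rewrite subr0.
Qed.

Lemma maxminors_colsE n l (L : 'M[R]_(n, l)) x :
  ideal_of (maxminors_cols L) x <-> ideal_of (maxminors_rows L^T) x.
Proof.
have trE (f : 'I_l -> 'I_n) : \det (rowsub f L) = \det (colsub f L^T).
  by rewrite -det_tr; congr (\det _); apply/matrixP => i j; rewrite !mxE.
split; apply: ideal_of_sub; try exact: ideal_ofP.
  by move=> y /imageP[f _ ->]; rewrite trE; apply: minor_rows_mem.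
move=> y /imageP[f _ ->]; rewrite -trE; apply: ideal_of_mem.
by apply/imageP; exists f.
Qed.

Lemma regular_seq_nonzero (s : seq R) : regular_seq s -> (0 < size s)%N -> s`_0 <> 0.
Proof.
move=> reg s_gt0 s0; apply: (negP (oner_neq0 R)); apply/eqP.
by apply: (regular_seq_head reg s_gt0); rewrite s0 mul0r.
Qed.

(** * Comparison of the two ideals when [X *m L = 0] *)

Section Complex.
Variables (m n l : nat) (X : 'M[R]_(m, n)) (a : seq R).
Hypotheses (le_mn : (m <= n)%N) (sz_a : size a = (n - m).+1).
Hypotheses (reg_a : regular_seq a) (l_gt0 : (0 < l)%N) (le_ln : (l <= n)%N).
Hypothesis minX : forall e, e \in a -> ideal_of (maxminors_rows X) e.
Hypothesis properX : ~ ideal_of (maxminors_rows X) 1.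
Variable L : 'M[R]_(n, l).
Hypothesis XL : X *m L = 0.

Let I_chi := ideal_of (maxminors_rows X).
Let I_lam := ideal_of (maxminors_cols L).
Let idX : is_ideal I_chi. Proof. exact: ideal_ofP. Qed.

Let a_gt0 : (0 < size a)%N. Proof. by rewrite sz_a. Qed.

Lemma complex_dot (i : 'I_m) (j : 'I_l) : dot (X i) (L^T j) = 0.
Proof.
have /matrixP/(_ i j) := XL; rewrite !mxE => <-.
by apply: eq_bigr => k _; rewrite mxE.
Qed.

Lemma complex_coef i j : I_chi (L i j).
Proof.
have n_gt0 : (0 < n)%N by apply: leq_trans le_ln.
have [t [_ Ht]] := kernel_factor n_gt0 le_mn sz_a reg_a minX (fun i => complex_dot i j).
by have := kernel_coef i Ht; rewrite mxE.
Qed.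

Lemma complex_minors_sub x : I_lam x -> I_chi x.
Proof.
apply: ideal_of_sub => // y /imageP[f _ ->]; apply: det_ideal => // i j.
by rewrite mxE; apply: complex_coef.
Qed.

Lemma complex_minors_eq0 x : (n - m < l)%N -> I_lam x -> x = 0.
Proof.
move=> lt_l /maxminors_colsE Ix; apply: (regular_seq_head reg_a a_gt0).
by apply: (minors_eq0 le_mn lt_l complex_dot) => //; apply/minX/mem_nth.
Qed.

Lemma complex_minors_grade : grade_ge I_lam (absdiff (n - m) l).+2 ->
  (l <= n - m)%N /\ forall x, I_chi x -> I_lam x.
Proof.
case=> [/complex_minors_sub//|[b [sz_b minL reg_b]]].
have b_gt0 : (0 < size b)%N by rewrite sz_b.
have le_l : (l <= n - m)%N.
  rewrite leqNgt; apply/negP => lt_l; apply: (regular_seq_nonzero reg_b b_gt0).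
  by apply: complex_minors_eq0 => //; apply/minL/mem_nth.
split=> // x Ix; apply/maxminors_colsE.
apply: (minors_sub le_mn _ b_gt0 reg_b _ complex_dot) Ix.
  (* Here [b] has length |rho| + 2, and the bound is r < (|rho| + 1) + l. *)
  by rewrite sz_b /absdiff /=; lia.
by move=> e /minL /maxminors_colsE.
Qed.

(** For the converse with l <= r, the sequence [a] lies in [I_lam], and l >= 1 gives |rho| + 2 <= r
    + 1. For l > r the ideal [I_lam] is zero and cannot contain the nonzero first element of [a]. *)
Lemma complex_grade_iff : grade_ge I_lam (absdiff (n - m) l).+2 <->
  forall x, I_chi x -> I_lam x.
Proof.
split=> [/complex_minors_grade[] //|sub].
have [le_l|lt_l] := leqP l (n - m).
  apply: (grade_ge_leq (k := (n - m).+1)); first by rewrite /absdiff; lia.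
  by right; exists a; split=> // e /minX /sub.
case: (regular_seq_nonzero reg_a a_gt0); apply: complex_minors_eq0 => //.
by apply/sub/minX/mem_nth.
Qed.

(** The entries of [L] lie in [I_chi], hence in [I_lam]; for l > 1 the minors lie in its square. The
    determinant trick gives [e] in [I_lam] fixing a_0, a nonzerodivisor, so e = 1, against
    properness. *)
Lemma complex_rank1 : (forall x, I_chi x -> I_lam x) -> l = 1%N.
Proof.
move=> sub; apply/eqP; rewrite eqn_leq l_gt0 andbT leqNgt; apply/negP => l_gt1.
have idL : is_ideal I_lam by apply: ideal_ofP.
have [e Ie He] : exists2 e, I_lam e & forall x, I_lam x -> e * x = x.
  apply: determinant_trick => y /imageP[f _ ->].
  set s := maxminors_cols L; have idS : is_ideal (ideal_of s) := idL.
  pose T x := exists2 c : 'I_(size s) -> R,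
    forall j, ideal_of s (c j) & x = \sum_j c j * s`_j.
  apply: (@det_ideal_square (ideal_of s) T) => //.
  - split=> [|u v [c Hc ->] [d Hd ->]|u v [c Hc ->]].
    + by exists (fun=> 0) => [_|]; [case: idS | rewrite big1 // => j _; rewrite mul0r].
    + exists (fun j => c j + d j) => [j|]; first by case: idS => _ ID _; apply: (ID).
      by rewrite -big_split; apply: eq_bigr => j _; rewrite mulrDl.
    + exists (fun j => u * c j) => [j|]; first by case: idS => _ _; apply.
      by rewrite mulr_sumr; apply: eq_bigr => j _; rewrite mulrA.
  - move=> u v Iu [c ->]; exists (fun j => u * c j) => [j|]; first exact: idealMr.
    by rewrite mulr_sumr; apply: eq_bigr => j _; rewrite mulrA.
  by move=> i j; rewrite mxE; apply/sub/complex_coef.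
have Ia0 : I_lam a`_0 by apply/sub/minX/mem_nth.
apply/properX/complex_minors_sub; rewrite -[1](subrK e) [1 - e](_ : _ = 0) ?add0r //.
by apply: (regular_seq_head reg_a a_gt0); rewrite mulrBr mulr1 [_ * e]mulrC He ?subrr.
Qed.

End Complex.

Lemma minor_cols1 n (L : 'M[R]_(n, 1)) i : ideal_of (maxminors_cols L) (L i 0).
Proof.
apply: ideal_of_mem; apply/imageP; exists [ffun=> i] => //.
by rewrite det_mx11 mxE ffunE.
Qed.

Lemma ideal_of_minors_cols1 n l (L : 'M[R]_(n, l)) (j : 'I_l) x : l = 1%N ->
  ideal_of (maxminors_cols L) x -> exists c, x = dot c (fun i => L i j).
Proof.
move=> l1; subst l.
apply: (ideal_of_sub (I := fun x => exists c, x = dot c (fun i => L i j))).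
  split=> [|u v [c ->] [d ->]|u v [c ->]].
  - by exists (fun=> 0); rewrite /dot big1 // => i _; rewrite mul0r.
  - exists (fun i => c i + d i); rewrite /dot -big_split.
    by apply: eq_bigr => i _; rewrite mulrDl.
  - exists (fun i => u * c i); rewrite /dot mulr_sumr.
    by apply: eq_bigr => i _; rewrite mulrA.
move=> y /imageP[f _ ->]; exists (unitv R (f ord0)).
rewrite det_mx11 mxE [j]ord1 /dot (bigD1 (f ord0)) //= /unitv eqxx mul1r big1 ?addr0 //.
by move=> i /negPf->; rewrite mul0r.
Qed.

End MaximalMinors.

(** * Homomorphisms with [I_chi] contained in [I_lam] *)

Section Constructions.
Variable R : comNzRingType.

(* The signed maximal minors, as in the Hilbert-Burch theorem. *)
Lemma corank1_complex m n (X : 'M[R]_(m, n)) : n = m.+1 ->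
  exists L : 'M[R]_(n, 1), X *m L = 0 /\
    forall x, ideal_of (maxminors_rows X) x -> ideal_of (maxminors_cols L) x.
Proof.
move=> En; pose L : 'M[R]_(n, 1) := \col_i covolume X [set i]; exists L; split.
  apply/matrixP => j z; rewrite !mxE.
  transitivity (wedges X (wedge (X j) (basis R set0)) setT : R); last first.
    by rewrite wedges_id ext0.
  have -> : wedge (X j) (basis R set0) = \sum_i X j i *: basis R [set i].
    apply/ffunP => S; rewrite ext_sum wedge_expand; apply: eq_bigr => i _.
    rewrite extZ wedge_unitv_basis ?inE // setU0 extZ /sg.
    rewrite (_ : [set j in set0 | _] = set0) ?cards0 ?mul1r //.
    by apply/setP => k; rewrite !inE.
  rewrite linear_sum /= ext_sum; apply: eq_bigr => i _.
  by rewrite linearZ /= extZ mxE covolumeE.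
apply: minor_covolume; first exact: ideal_ofP.
have idL := ideal_ofP (maxminors_cols L).
move=> S; have [/cards1P[i ->]|neq] := boolP (#|S| == 1)%N.
  by have := minor_cols1 L i; rewrite mxE.
have le_mn : (m <= n)%N by rewrite En.
have nm1 : (n - m = 1)%N by rewrite En subSnn.
have hL := homog_covolume X le_mn; rewrite nm1 in hL.
by rewrite (homog_eq0 hL) ?addn0 //; case: idL.
Qed.

Lemma unit_minor0 m n (X : 'M[R]_(m, n)) :
  m = 0%N -> ideal_of (maxminors_rows X) 1.
Proof.
move=> m0; subst m.
by have := minor_rows_mem X (widen_ord (leq0n n)); rewrite det_mx00.
Qed.

(** Coordinates are paired, 0 with 1, 2 with 3 and so on; the column (x_1, -x_0, x_3, -x_2, ...) is
    orthogonal to the row and has the same entries up to sign and order. *)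
Lemma rank1_complex m n (X : 'M[R]_(m, n)) : m = 1%N -> ~~ odd n ->
  exists L : 'M[R]_(n, 1), X *m L = 0 /\
    forall x, ideal_of (maxminors_rows X) x -> ideal_of (maxminors_cols L) x.
Proof.
move=> m1 even_n; subst m.
have lt_swap (i : 'I_n) : ((if odd i then i.-1 else i.+1) < n)%N.
  have := ltn_ord i; case: ifPn => [_|odd_i]; first by lia.
  by rewrite leq_eqVlt => /predU1P[eqn|//]; rewrite -eqn /= odd_i in even_n.
pose s i := Ordinal (lt_swap i).
have odd_s i : odd (s i) = ~~ odd i by rewrite /s /=; case: ifPn => /=; lia.
have sK : involutive s.
  by move=> i; apply: val_inj; rewrite [LHS]/= odd_s /=; case: (boolP (odd i)) => /=; lia.
pose L : 'M[R]_(n, 1) := \col_i ((-1) ^+ odd i * X 0 (s i)); exists L; split.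
  apply/matrixP => j z; rewrite !mxE; apply: (sum_involution sK) => i.
    by rewrite !mxE sK odd_s [j]ord1; case: (odd i) => /=; ring.
  by move/(congr1 (fun k : 'I_n => odd k)); rewrite odd_s; case: (odd i).
have idL := ideal_ofP (maxminors_cols L).
move=> x; apply: (ideal_of_minors_rows idL) => f; rewrite det_mx11 mxE.
have := minor_cols1 L (s (f ord0)); rewrite mxE sK => /(idealMr ((-1) ^+ odd (s (f ord0))) idL).
by rewrite mulrAC -expr2 sqrr_sign mul1r.
Qed.

End Constructions.

(** * Grade bounds and classification *)

Unset Implicit Arguments.

Theorem mainTheorem12 (R : comNzRingType) (m n l : nat) (X : 'M[R]_(m, n)) :
  noetherian R ->
  (m <= n)%N ->
  (forall u : 'rV[R]_m, u *m X = 0 -> u = 0) ->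
  grade_ge (ideal_of (maxminors_rows X)) (n - m).+1 ->
  ~ grade_ge (ideal_of (maxminors_rows X)) (n - m).+2 ->
  (1 <= l)%N -> (l <= n)%N ->
  let r := (n - m)%N in
  let I_chi := ideal_of (maxminors_rows X) in
  let I_lam := fun L : 'M[R]_(n, l) => ideal_of (maxminors_cols L) in
  let good := fun L : 'M[R]_(n, l) => grade_ge (I_lam L) (absdiff r l).+2 in
  (forall L : 'M[R]_(n, l), X *m L = 0 ->
     (forall x, I_lam L x -> I_chi x) /\ ~ grade_ge (I_lam L) r.+2)
  /\ ((exists L : 'M[R]_(n, l), X *m L = 0 /\ good L) -> l = 1%N /\ odd r)
  /\ (minimal_mx X ->
       ((exists L : 'M[R]_(n, l), X *m L = 0 /\ good L) <->
        (l = 1%N /\ (r = 1%N \/ (m = 1%N /\ (3 <= r)%N /\ odd r)))))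
  /\ (forall L : 'M[R]_(n, l), X *m L = 0 ->
        (good L <-> (forall x, I_lam L x <-> I_chi x))).
Proof.
move=> _ le_mn _ grade_chi grade_chi' l_gt0 le_ln r I_chi I_lam good.
have idX : is_ideal I_chi by apply: ideal_ofP.
have properX : ~ I_chi 1 by move=> I1; apply: grade_chi'; left.
(* For m = 0 the empty determinant 1 would be a minor. *)
have m_gt0 : (0 < m)%N.
  by case: (posnP m) => // m0; case: properX; apply: unit_minor0.
have n_gt0 : (0 < n)%N by apply: leq_trans le_mn.
have [//|[a [sz_a minX reg_a]]] := grade_chi.
have sub L := @complex_minors_sub _ _ _ _ X a le_mn sz_a reg_a l_gt0 le_ln minX L.
have iffL L := @complex_grade_iff _ _ _ _ X a le_mn sz_a reg_a l_gt0 le_ln minX properX L.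
have eq_l1 L : X *m L = 0 -> good L -> l = 1%N.
  move=> XL /(iffL L XL).
  exact: (complex_rank1 le_mn sz_a reg_a l_gt0 le_ln minX properX XL).
have span L : X *m L = 0 -> good L -> exists t, forall y : ext R n, homog 0 r y ->
    exists c (b : 'I_m -> ext R n), y = wedge c t + \sum_j wedge (X j) (b j).
  move=> XL goodL; have minL := (iffL L XL).1 goodL; have El := eq_l1 L XL goodL.
  pose j0 := Ordinal l_gt0.
  have [|t [ht Ht]] :=
    kernel_factor n_gt0 le_mn sz_a reg_a minX (v := fun i => L i j0).
    move=> j; rewrite -[RHS](complex_dot XL j j0).
    by apply: eq_bigr => i _; rewrite mxE.
  exists t => y hy; apply: (top_forms m_gt0 le_mn sz_a reg_a minX ht Ht) hy => e /minL.
  exact: ideal_of_minors_cols1.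
have rank1 L : X *m L = 0 -> good L -> l = 1%N /\ odd r.
  move=> XL goodL; have [t Ht] := span L XL goodL.
  by split; [apply: (eq_l1 L) | apply: (odd_corank m_gt0 le_mn properX Ht)].
split; [|split; [|split]].
- move=> L XL; split=> [x|]; first exact: sub.
  by move/(grade_ge_sub (sub L XL)).
- by case=> L [XL goodL]; apply: (rank1 L).
- move=> minimalX; split=> [[L [XL goodL]]|[El r13]].
    have [El odd_r] := rank1 L XL goodL; split=> //.
    have [r1|r_neq1] := eqVneq r 1%N; [by left | right].
    have r_ge3 : (3 <= r)%N by move: odd_r r_neq1; case: (r) => [|[|[|]]].
    split=> //; apply/eqP; rewrite eqn_leq m_gt0 andbT leqNgt; apply/negP => m_gt1.
    have [t Ht] := span L XL goodL.
    (* Minimality makes the ideal of entries proper, so the binomial coefficient is at most n; this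
       contradicts n = m + r >= r + 2. *)
    have := card_sets_le (ideal_ofP _) minimalX _ Ht; rewrite leqNgt bin_gt //.
    + by move=> H; apply: notF; apply: H => j i; apply: ideal_of_mem; apply/imageP; exists (j, i).
    + exact: ltnW.
    + by move: m_gt1 r_ge3; rewrite /r; lia.
  suff [L [XL minL]] : exists L : 'M[R]_(n, l), X *m L = 0 /\ forall x, I_chi x -> I_lam L x.
    by exists L; split=> //; apply/iffL.
  rewrite /I_lam El.
  case: r13 => [r1|[m1 [_ odd_r]]].
    by apply: corank1_complex; move: r1; rewrite /r; lia.
  (* With m = 1 and r odd, n = r + 1 is even. *)
  by apply: rank1_complex => //; move: odd_r; rewrite /r m1 oddB -?m1 //= m1 addbT.
- move=> L XL; rewrite /good iffL //; split=> [minL x|eqI x]; last by case: (eqI x).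
  by split; [apply: sub | apply: minL].
Qed.
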